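(* Let $(M,F)$ be a conic pseudo-Finsler surface with $F$ defined on the conic sub-bundle $\mathcal A$, let $\phi:\mathcal A\to\mathbb R$ be a smooth function positively homogeneous of degree $0$ in $y$ with $\sigma+\varepsilon-(\phi_{;2})^2\neq0$ on $\mathcal A$, where $\sigma=\phi_{;2;2}+\varepsilon\mathcal I\phi_{;2}+2(\phi_{;2})^2$; put $\rho=1/(\sigma+\varepsilon-(\phi_{;2})^2)$ and $\overline F=e^{\phi}F$. Then the coefficients $\overline G^i_j$ and $G^i_j$ of the Barthel connections of $\overline F$ and $F$ are related by $$F\,\overline G^i_j=F\,G^i_j+2P\,\ell^i\ell_j+(P_{;2}-Q)\,\ell^im_j+2Q\,\ell_jm^i+(\varepsilon P+Q_{;2}-\varepsilon\mathcal I Q)\,m^im_j,$$ where $2Q=\varepsilon\rho F^2(\phi_{;2}\phi_{,1}+\phi_{,1;2}-2\phi_{,2})$ and $2P=-\rho F^2\phi_{;2}(\phi_{;2}\phi_{,1}+\phi_{,1;2}-2\phi_{,2})+F^2\phi_{,1}$.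
   Context: Let $M$ be a smooth 2-dimensional manifold, $(x^1,x^2)$ local coordinates and $(x^i,y^i)$ the induced coordinates on $TM$; all formulas are in such a coordinate system and repeated indices are summed over $\{1,2\}$. Write $\partial_i=\partial/\partial x^i$, $\dot\partial_i=\partial/\partial y^i$. A function is $h(r)$ if it is positively homogeneous of degree $r$ in $y$. A conic sub-bundle is a non-empty open subset $\mathcal A\subset TM\setminus 0$ projecting onto $M$ and closed under multiplication by positive scalars. A conic pseudo-Finsler metric on $M$ is a smooth $h(1)$ function $F:\mathcal A\to\mathbb R$ such that $g_{ij}=\tfrac12\dot\partial_i\dot\partial_jF^2$ is non-degenerate at each point of $\mathcal A$; $(g^{ij})$ is the inverse matrix. A conic pseudo-Finsler surface is equipped with its modified Berwald frame: $F$ is nowhere zero on $\mathcal A$, $\ell_i=\dot\partial_iF$, $\ell^i=y^i/F$, $\varepsilon\in\{1,-1\}$ (the signature) is the sign of $\det(g_{ij})$, $m_1=-\sqrt{\varepsilon\det(g_{ij})}\,\ell^2$, $m_2=\sqrt{\varepsilon\det(g_{ij})}\,\ell^1$, $m^i=g^{ij}m_j$; thus $g_{ij}=\ell_i\ell_j+\varepsilon m_im_j$, $\ell^im_i=0$, $m^im_i=\varepsilon$. The main scalar $\mathcal I$ is defined by $F\,C_{ijk}=\mathcal I\,m_im_jm_k$, where $C_{ijk}=\tfrac12\dot\partial_kg_{ij}$. The geodesic spray coefficients of $F$ are $G^i=\tfrac14g^{ij}(y^k\dot\partial_j\partial_kF^2-\partial_jF^2)$; the Barthel (Cartan nonlinear)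 connection has coefficients $G^i_j=\dot\partial_jG^i$, and $\delta_i=\partial_i-G^j_i\dot\partial_j$. $\overline G^i$, $\overline G^i_j$ are defined in the same way from $\overline F$ (the condition $\sigma+\varepsilon-(\phi_{;2})^2\ne0$ guarantees that $\overline F$ is a conic pseudo-Finsler metric). For a smooth function $f$ on $\mathcal A$: $f_{;2}:=\varepsilon F(\dot\partial_if)m^i$, $f_{,1}:=(\delta_if)\ell^i$, $f_{,2}:=\varepsilon(\delta_if)m^i$, and iterated symbols are read left to right, e.g. $f_{;2;2}=(f_{;2})_{;2}$, $f_{,1;2}=(f_{,1})_{;2}$. *)

(* Defs.v *)
From HB Require Import structures.
From mathcomp Require Import all_boot all_order all_algebra.
From mathcomp Require Import all_classical all_reals all_analysis.

Set Implicit Arguments.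
Unset Strict Implicit.
Unset Printing Implicit Defensive.

Import Order.TTheory GRing.Theory Num.Theory.
Import numFieldNormedType.Exports.

Local Open Scope classical_set_scope.
Local Open Scope ring_scope.

(* Smoothness (C^oo) on an open set A: every iterated directional derivative
   is Frechet differentiable at every point of A. *)
Definition smooth_on (R : realType) (V W : normedModType R) (A : set V)
    (f : V -> W) : Prop :=
  forall (s : seq V) (z : V), A z ->
    differentiable (foldr (fun v g => 'D_v g) f s) z.

(* A smooth 2-dimensional manifold, presented by an atlas (not assumed to be
   maximal).  [chart_inv c] is the inverse of the chart [chart_coord c]; the
   values of [chart_coord c] outside [chart_dom c], and of [chart_inv c] outside
   the image of [chart_dom c], are irrelevant. *)
Record surface (R : realType) := Surface {
  spoint :> topologicalType;
  chart : Type;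
  chart_dom : chart -> set spoint;
  chart_coord : chart -> spoint -> 'rV[R]_2;
  chart_inv : chart -> 'rV[R]_2 -> spoint;
  _ : hausdorff_space spoint;
  _ : @second_countable spoint;
  _ : \bigcup_c chart_dom c = [set: spoint];
  _ : forall c, open (chart_dom c);
  _ : forall c, open (chart_coord c @` chart_dom c);
  _ : forall c, {in chart_dom c, cancel (chart_coord c) (chart_inv c)};
  _ : forall c, {within chart_dom c, continuous (chart_coord c)};
  _ : forall c, {within chart_coord c @` chart_dom c, continuous (chart_inv c)};
  _ : forall c c', smooth_on (chart_coord c @` (chart_dom c `&` chart_dom c'))
                             (chart_coord c' \o chart_inv c)
}.

Section TangentBundle.
Variables (R : realType) (M : surface R).

(* A point (x, y) of TM in the coordinates induced by a chart. *)
Local Notation TV := ('rV[R]_2 * 'rV[R]_2)%type.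

Definition overlap (c c' : chart M) : set 'rV[R]_2 :=
  chart_coord c @` (chart_dom c `&` chart_dom c').

Definition transition (c c' : chart M) : 'rV[R]_2 -> 'rV[R]_2 :=
  chart_coord c' \o chart_inv c.

Definition tangent_transition (c c' : chart M) (z : TV) : TV :=
  (transition c c' z.1, 'd (transition c c') (z.1) z.2).

(* TM is the gluing of the sets (chart_coord c @` chart_dom c) * R^2 along the
   maps [tangent_transition c c'].  A subset of TM is therefore a family of
   subsets of these pieces which is compatible with the gluing, and a function
   on it is a compatible family of local expressions. *)
Record conic_subbundle (A : chart M -> set TV) : Prop := ConicSubbundle {
  cs_sub : forall c z, A c z -> (chart_coord c @` chart_dom c) z.1 /\ z.2 != 0;
  cs_compat : forall c c' z, overlap c c' z.1 ->
    (A c z <-> A c' (tangent_transition c c' z));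
  cs_nonempty : exists c, A c !=set0;
  cs_open : forall c, open (A c);
  cs_proj : forall c x, (chart_coord c @` chart_dom c) x ->
    exists y, A c (x, y);
  cs_conic : forall c z (k : R), A c z -> 0 < k -> A c (z.1, k *: z.2)
}.

Definition function_on (A : chart M -> set TV) (f : chart M -> TV -> R) :
    Prop :=
  forall c c' z, A c z -> overlap c c' z.1 ->
    f c z = f c' (tangent_transition c c' z).

Definition smooth_function (A : chart M -> set TV) (f : chart M -> TV -> R) :
    Prop :=
  function_on A f /\ forall c, smooth_on (A c) (f c).

Definition homogeneous (r : nat) (A : chart M -> set TV)
    (f : chart M -> TV -> R) : Prop :=
  forall c z (k : R), A c z -> 0 < k -> f c (z.1, k *: z.2) = k ^+ r * f c z.

End TangentBundle.

(* Coordinate formulas, for functions of z = (x, y); the indices 1, 2 are the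
   elements 0, 1 of 'I_2, and f, F are the expressions of functions in a fixed
   chart. *)
Section Coordinates.
Variable R : realType.
Local Notation TV := ('rV[R]_2 * 'rV[R]_2)%type.
Implicit Types (F phi f Isc : TV -> R) (i j k : 'I_2) (z : TV).

Definition dx i f : TV -> R := 'D_((delta_mx 0 i, 0) : TV) f.
Definition dy i f : TV -> R := 'D_((0, delta_mx 0 i) : TV) f.

Definition ycoord i z : R := z.2 0 i.

Definition sqF F z : R := F z ^+ 2.

Definition gmx F z : 'M[R]_2 := \matrix_(i, j) (2^-1 * dy i (dy j (sqF F)) z).
Definition g_lo F i j z : R := gmx F z i j.
Definition g_up F i j z : R := invmx (gmx F z) i j.

(* the signature: the sign of det(g_ij), evaluated pointwise (so it is only
   locally constant if the domain of F is disconnected) *)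
Definition eps F z : R := Num.sg (\det (gmx F z)).

Definition l_lo F i z : R := dy i F z.
Definition l_up F i z : R := ycoord i z / F z.

Definition m_lo F i z : R :=
  if i == 0 then - Num.sqrt (eps F z * \det (gmx F z)) * l_up F 1 z
  else Num.sqrt (eps F z * \det (gmx F z)) * l_up F 0 z.
Definition m_up F i z : R := \sum_j g_up F i j z * m_lo F j z.

Definition cartan F i j k z : R := 2^-1 * dy k (g_lo F i j) z.

Definition is_main_scalar (A : set TV) F Isc : Prop :=
  forall z, A z -> forall i j k,
    F z * cartan F i j k z = Isc z * m_lo F i z * m_lo F j z * m_lo F k z.

Definition spray F i z : R :=
  4^-1 * \sum_j g_up F i j z *
    (\sum_k ycoord k z * dy j (dx k (sqF F)) z - dx j (sqF F) z).

Definition barthel F i j : TV -> R := dy j (spray F i).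

Definition delta F i f z : R :=
  dx i f z - \sum_j barthel F j i z * dy j f z.

(* f_{;2}, f_{,1} and f_{,2} *)
Definition v2 F f z : R := eps F z * F z * \sum_i dy i f z * m_up F i z.
Definition h1 F f z : R := \sum_i delta F i f z * l_up F i z.
Definition h2 F f z : R := eps F z * \sum_i delta F i f z * m_up F i z.

Definition sigma F Isc phi z : R :=
  v2 F (v2 F phi) z + eps F z * Isc z * v2 F phi z + 2 * v2 F phi z ^+ 2.

Definition rho F Isc phi z : R :=
  (sigma F Isc phi z + eps F z - v2 F phi z ^+ 2)^-1.

Definition scalQ F Isc phi z : R :=
  2^-1 * (eps F z * rho F Isc phi z * F z ^+ 2 *
    (v2 F phi z * h1 F phi z + v2 F (h1 F phi) z - 2 * h2 F phi z)).

Definition scalP F Isc phi z : R :=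
  2^-1 * (- rho F Isc phi z * F z ^+ 2 * v2 F phi z *
    (v2 F phi z * h1 F phi z + v2 F (h1 F phi) z - 2 * h2 F phi z)
    + F z ^+ 2 * h1 F phi z).

Definition conformal phi F z : R := expR (phi z) * F z.

End Coordinates.

Section PseudoFinsler.
Variables (R : realType) (M : surface R).
Local Notation TV := ('rV[R]_2 * 'rV[R]_2)%type.

(* A conic pseudo-Finsler metric F, nowhere zero so that the modified Berwald
   frame is defined. *)
Record conic_pseudo_Finsler_surface (A : chart M -> set TV)
    (F : chart M -> TV -> R) : Prop := ConicPseudoFinslerSurface {
  pf_subbundle : conic_subbundle A;
  pf_smooth : smooth_function A F;
  pf_homogeneous : homogeneous 1 A F;
  pf_nondegenerate : forall c z, A c z -> gmx (F c) z \in unitmx;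
  pf_nonzero : forall c z, A c z -> F c z != 0
}.

End PseudoFinsler.

(* Main.v *)
Require Import Defs.
From HB Require Import structures.
From mathcomp Require Import all_boot all_order all_algebra.
From mathcomp Require Import all_classical all_reals all_analysis.
From mathcomp Require Import ring lra.
Import Order.TTheory GRing.Theory Num.Theory.
Import numFieldNormedType.Exports.
Local Open Scope classical_set_scope.
Local Open Scope ring_scope.

(* Write l_i, m_i for the Berwald coframe and L = F^2.  For f homogeneous of
   degree r, F d'_j f = r f l_j + f_;2 m_j, and differentiating g = l l + e m m
   gives the vertical derivatives of the frame: F d'_k l^i = e m^i m_k and
   F d'_k m^i = - (l^i + e I m^i) m_k.  Hence it is enough to show that the
   sprays satisfy Gbar^i = G^i + P l^i + Q m^i and to differentiate this relation.

   The geodesic equation determines Gbar by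
   4 gbar_jk Gbar^k = y^k d'_j d_k f - d_j f with f = Fbar^2, and for every f,
     y^k d'_j d_k f - d_j f = d'_j (S f) - 2 delta_j f + 2 G^k d'_j d'_k f
   where S = y^k d_k - 2 G^k d'_k.  For f = exp(2 phi) L the derivations S and
   delta_j only act on phi, since both kill L; comparing with
   gbar = exp(2 phi) (l l + phi_;2 (m l + l m) + (sigma + e) m m)
   leaves a 2 x 2 linear system for (P, Q) with determinant proportional to
   1 / rho.

   The signature e is only locally constant, so all this is done on the open
   set where it takes a given value. *)

Set Implicit Arguments.
Unset Strict Implicit.
Unset Printing Implicit Defensive.

(** * Smooth functions *)

(** The first-order expansion of [f] at [z] is also one of [g], because only small increments
    matter; hence ['d f z] is the differential of [g] too. *)
Lemma near_eq_differentiable {R : numFieldType} {V W : normedModType R}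
    {f g : V -> W} {z : V} :
  (\near z, f z = g z) -> differentiable f z -> differentiable g z.
Proof.
move=> fg df.
have eq0 : \forall h \near 0, g (h + z) = f (h + z).
  have : \forall y \near z, g y = f y by near do apply/esym.
  by rewrite (near_shift 0 z); apply: filterS => h; rewrite /= subr0.
have gE : g \o shift z = cst (g z) + 'd f z +o_ 0 id.
  apply/eqaddoP => _/posnumP[e].
  have /eqaddoP /(_ e%:num) := diff_locally df.
  rewrite gt0 => /(_ isT) dfz; near=> h.
  have -> : (g \o shift z - (cst (g z) + 'd f z)) h =
      (f \o shift z - (cst (f z) + 'd f z)) h.
    rewrite !fctE /= (near eq0 h) //.
    by rewrite (nbhs_singleton fg).
  by near: h.
have dfc := diff_continuous df.
by apply/diff_locallyP; rewrite (diff_unique dfc gE).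
Unshelve. all: by end_near. Qed.

Section SmoothFunctions.
Context {R : realType} {V : normedModType R} {A : set V}.
Hypothesis openA : open A.
Implicit Types f g : V -> R.

Lemma open_near_eq {f g z} : (forall z, A z -> f z = g z) -> A z ->
  \near z, f z = g z.
Proof.
by move=> fg Az; apply: filterS (open_nbhs_nbhs (conj openA Az)) => y /fg.
Qed.

Lemma derive_ext_on {f g z} v :
  (forall z, A z -> f z = g z) -> A z -> 'D_v f z = 'D_v g z.
Proof. by move=> fg Az; apply: near_eq_derive; exact: open_near_eq. Qed.

Lemma smooth_on_differentiable {f z} :
  smooth_on A f -> A z -> differentiable f z.
Proof. by move=> sf Az; exact: (sf [::]). Qed.

Lemma smooth_on_derivable {f z} v : smooth_on A f -> A z -> derivable f z v.
Proof. by move=> sf Az; exact/diff_derivable/smooth_on_differentiable. Qed.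

Lemma smooth_on_derive {f} v : smooth_on A f -> smooth_on A ('D_v f).
Proof.
(* [foldr] applies the last entry of the list first, so appending [v] at the end makes ['D_v f] the
   innermost function. *)
move=> sf s z Az; have := sf (rcons s v) z Az.
by rewrite -cats1 foldr_cat.
Qed.

Lemma deriveD_on {f g z} v : smooth_on A f -> smooth_on A g -> A z ->
  'D_v (fun z => f z + g z) z = 'D_v f z + 'D_v g z.
Proof. by move=> sf sg Az; apply: deriveD; exact: smooth_on_derivable. Qed.

Lemma deriveM_on {f g z} v : smooth_on A f -> smooth_on A g -> A z ->
  'D_v (fun z => f z * g z) z = f z * 'D_v g z + g z * 'D_v f z.
Proof. by move=> sf sg Az; apply: deriveM; exact: smooth_on_derivable. Qed.

Lemma deriveV_on {f z} v : smooth_on A f -> A z -> f z != 0 ->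
  'D_v (fun z => (f z)^-1) z = - (f z) ^- 2 * 'D_v f z.
Proof. by move=> sf Az f0; apply: deriveV => //;
  exact: smooth_on_derivable. Qed.

Lemma derive_comp_real {f z} {h : R -> R} {dh} v : differentiable f z ->
  is_derive (f z) 1 h dh -> 'D_v (fun z => h (f z)) z = dh * 'D_v f z.
Proof.
move=> df [/derivable1_diffP dfh <-].
rewrite [LHS]deriveE; last exact: differentiable_comp.
(* The differential of [h] on the real line is multiplication by its value at 1, which is [dh]. *)
rewrite diff_comp //= !deriveE // -[X in 'd h _ X = _]mulr1.
by rewrite [LHS]linearZ mulrC.
Qed.

Lemma derive_sqrt_on {f z} v : smooth_on A f -> A z -> 0 < f z ->
  'D_v (fun z => Num.sqrt (f z)) z = (2 * Num.sqrt (f z))^-1 * 'D_v f z.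
Proof.
move=> sf Az /is_derive1_sqrt; apply: (derive_comp_real (h := Num.sqrt)).
exact: smooth_on_differentiable.
Qed.

Lemma derive_expR_on {f z} v : smooth_on A f -> A z ->
  'D_v (fun z => expR (f z)) z = expR (f z) * 'D_v f z.
Proof.
move=> sf Az; apply: (derive_comp_real (h := expR)).
exact: smooth_on_differentiable.
Qed.

(* Every operation below maps the class to differentiable functions whose
   directional derivatives are again in the class. *)
Inductive elementary : (V -> R) -> Prop :=
| elementary_smooth f : smooth_on A f -> elementary f
| elementary_cst a : elementary (fun=> a)
| elementary_affine f (df : V -> R) : (forall z, differentiable f z) ->
    (forall z v, 'D_v f z = df v) -> elementary f
| elementary_add f g : elementary f -> elementary g ->
    elementary (fun z => f z + g z)
| elementary_mul f g : elementary f -> elementary g ->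
    elementary (fun z => f z * g z)
| elementary_inv f : elementary f -> (forall z, A z -> f z != 0) ->
    elementary (fun z => (f z)^-1)
| elementary_sqrt f : elementary f -> (forall z, A z -> 0 < f z) ->
    elementary (fun z => Num.sqrt (f z))
| elementary_exp f : elementary f -> elementary (fun z => expR (f z))
| elementary_ext f g : elementary f -> (forall z, A z -> f z = g z) ->
    elementary g.

Lemma elementary_derive f : elementary f ->
  (forall z, A z -> differentiable f z) /\ forall v, elementary ('D_v f).
Proof.
elim=> {f} [f sf|a|f Df df fE|f g _ [df Df] _ [dg Dg]|f g ef [df Df] eg [dg Dg]
    |f ef [df Df] f0|f ef [df Df] f0|f ef [df Df]|f g _ [df Df] fg].
- split=> [z|v]; first exact: smooth_on_differentiable.
  exact/elementary_smooth/smooth_on_derive.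
- split=> [z _|v]; first exact: differentiable_cst.
  by apply: elementary_ext (elementary_cst 0) _ => z _; rewrite derive_cst.
- split=> [z _|v]; first exact: df.
  by apply: elementary_ext (elementary_cst (Df v)) _ => z _; rewrite fE.
- split=> [z Az|v]; first by apply: differentiableD; [exact: df|exact: dg].
  apply: elementary_ext (elementary_add (Df v) (Dg v)) _ => z Az.
  by apply/esym/deriveD; apply: diff_derivable; [exact: df|exact: dg].
- split=> [z Az|v]; first by apply: differentiableM; [exact: df|exact: dg].
  apply: elementary_ext
    (elementary_add (elementary_mul ef (Dg v)) (elementary_mul eg (Df v))) _.
  move=> z Az.
  by apply/esym/deriveM; apply: diff_derivable; [exact: df|exact: dg].
- split=> [z Az|v]; first by apply: differentiableV; [exact: df|exact: f0].
  have eV := elementary_inv ef f0.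
  apply: elementary_ext (elementary_mul (elementary_cst (-1))
    (elementary_mul (elementary_mul eV eV) (Df v))) _ => z Az.
  rewrite [RHS]deriveV; [|exact: f0|exact/diff_derivable/df].
  by rewrite mulN1r -invfM -expr2 scaleNr.
- split=> [z Az|v].
    apply: (@differentiable_comp _ _ _ _ f Num.sqrt); first exact: df.
    by apply/derivable1_diffP; have [] := is_derive1_sqrt (f0 z Az).
  have e2s : elementary (fun z => (2 * Num.sqrt (f z))^-1).
    apply: (elementary_inv (f := fun z => 2 * Num.sqrt (f z))).
      exact: elementary_mul (elementary_cst 2) (elementary_sqrt ef f0).
    by move=> z Az; rewrite mulf_neq0 ?pnatr_eq0 // lt0r_neq0 // sqrtr_gt0 f0.
  apply: elementary_ext (elementary_mul e2s (Df v)) _ => z Az.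
  by apply/esym/(derive_comp_real (h := Num.sqrt));
    [exact: df|exact/is_derive1_sqrt/f0].
- have dE x : differentiable (expR : R -> R) x.
    exact/derivable1_diffP/derivable_expR.
  split=> [z Az|v].
    by apply: (@differentiable_comp _ _ _ _ f expR); [exact: df|exact: dE].
  apply: elementary_ext (elementary_mul (elementary_exp ef) (Df v)) _ => z Az.
  by apply/esym/(derive_comp_real (h := expR)); exact: df.
- split=> [z Az|v].
    exact: near_eq_differentiable (open_near_eq fg Az) (df z Az).
  by apply: elementary_ext (Df v) _ => z; exact: derive_ext_on.
Qed.

(** All iterated derivatives of an elementary function stay elementary, hence differentiable. The
    closure rules for [smooth_on] below are read off from the constructors, without formulas for
    iterated derivatives of products, quotients or compositions. *)
Lemma elementary_smooth_on f : elementary f -> smooth_on A f.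
Proof.
move=> ef s z; suff es : elementary (foldr (fun v g => 'D_v g) f s).
  by move=> Az; exact: (elementary_derive es).1.
by elim: s => //= v s /elementary_derive[].
Qed.

Lemma smooth_on_cst a : smooth_on A (fun=> a : R).
Proof. exact/elementary_smooth_on/elementary_cst. Qed.

Lemma smooth_on_affine f (df : V -> R) : (forall z, differentiable f z) ->
  (forall z v, 'D_v f z = df v) -> smooth_on A f.
Proof.
by move=> Df fE; apply: elementary_smooth_on; exact: elementary_affine Df fE.
Qed.

Lemma smooth_onD f g : smooth_on A f -> smooth_on A g ->
  smooth_on A (fun z => f z + g z).
Proof.
move=> sf sg; apply: elementary_smooth_on.
by apply: elementary_add; exact: elementary_smooth.
Qed.

Lemma smooth_onM f g : smooth_on A f -> smooth_on A g ->
  smooth_on A (fun z => f z * g z).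
Proof.
move=> sf sg; apply: elementary_smooth_on.
by apply: elementary_mul; exact: elementary_smooth.
Qed.

Lemma smooth_onV f : smooth_on A f -> (forall z, A z -> f z != 0) ->
  smooth_on A (fun z => (f z)^-1).
Proof.
move=> sf f0; apply: elementary_smooth_on.
by apply: elementary_inv => //; exact: elementary_smooth.
Qed.

Lemma smooth_on_sqrt f : smooth_on A f -> (forall z, A z -> 0 < f z) ->
  smooth_on A (fun z => Num.sqrt (f z)).
Proof.
move=> sf f0; apply: elementary_smooth_on.
by apply: elementary_sqrt => //; exact: elementary_smooth.
Qed.

Lemma smooth_on_expR f : smooth_on A f -> smooth_on A (fun z => expR (f z)).
Proof.
by move=> sf; apply: elementary_smooth_on;
  exact/elementary_exp/elementary_smooth.
Qed.

Lemma smooth_on_ext f g :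
  smooth_on A f -> (forall z, A z -> f z = g z) -> smooth_on A g.
Proof.
by move=> sf fg; apply: elementary_smooth_on;
  exact: elementary_ext (elementary_smooth sf) fg.
Qed.

End SmoothFunctions.

(** * Symmetry of second derivatives *)

(** Reduces directional derivatives to derivatives in one real variable, as the mean value theorem
    and Euler's relation require. The two difference quotients are the same function of the
    increment. *)
Lemma is_derive_line {R : realType} {V : normedModType R} (f : V -> R)
    (v x : V) (t : R) : differentiable f (t *: v + x) ->
  is_derive t 1 (fun u => f (u *: v + x)) ('D_v f (t *: v + x)).
Proof.
move=> df; have /derivableP [] : derivable f (t *: v + x) v.
  exact: diff_derivable.
have rateE : (fun h : R => h^-1 *: (((fun u => f (u *: v + x)) \o shift t)
    (h *: 1) - f (t *: v + x))) =
    (fun h => h^-1 *: ((f \o shift (t *: v + x)) (h *: v) - f (t *: v + x))).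
  by apply/funext => h /=; rewrite [h *: 1]mulr1 scalerDl addrA.
by move=> dfv _; split; rewrite /derivable /derive rateE.
Qed.

(* Apply the mean value theorem twice, first along [v], then along [w]. *)
Lemma second_difference {R : realType} {V : normedModType R} {A : set V}
    (f : V -> R) (z v w : V) (s : R) : smooth_on A f -> 0 < s ->
  (forall a b, 0 <= a <= s -> 0 <= b <= s -> A (a *: v + (b *: w + z))) ->
  exists a b, [/\ 0 <= a <= s, 0 <= b <= s &
    f (s *: v + (s *: w + z)) - f (s *: v + z) - (f (s *: w + z) - f z) =
      'D_w ('D_v f) (a *: v + (b *: w + z)) * s * s].
Proof.
move=> sf s0 sA.
have s1 : 0 <= s <= s by rewrite ltW //=.
have z1 : (0 : R) <= 0 <= s by rewrite lexx ltW .
(* The increment in direction [w], as a function of the coordinate along [v]. Writing [0 *: w] lets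
   [sA] apply with second coordinate 0. *)
have dphi t : 0 <= t <= s -> is_derive t 1
    (fun t => f (t *: v + (s *: w + z)) - f (t *: v + (0 *: w + z)))
    ('D_v f (t *: v + (s *: w + z)) - 'D_v f (t *: v + (0 *: w + z))).
  move=> ts; have d1 := is_derive_line (smooth_on_differentiable sf (sA _ _ ts
    s1)).
  have d0 := is_derive_line (smooth_on_differentiable sf (sA _ _ ts z1)).
  exact: is_deriveB.
have [a aI fE] := MVT s0 (fun t (tI : t \in `]0, s[) =>
  dphi t (subset_itv_oo_cc tI)) (derivable_within_continuous
   (fun t (tI : t \in `[0, s]) => let: DeriveDef d _ := dphi t tI in d)).
have as' : 0 <= a <= s by exact: subset_itv_oo_cc aI.
have dpsi t : 0 <= t <= s -> is_derive t 1
    (fun t => 'D_v f (t *: w + (a *: v + z)))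
    ('D_w ('D_v f) (t *: w + (a *: v + z))).
  move=> ts; apply: is_derive_line.
  by apply: (smooth_on_differentiable (smooth_on_derive _ sf)); rewrite addrCA;
    exact: sA.
have [b bI gE] := MVT s0 (fun t (tI : t \in `]0, s[) =>
  dpsi t (subset_itv_oo_cc tI)) (derivable_within_continuous
   (fun t (tI : t \in `[0, s]) => let: DeriveDef d _ := dpsi t tI in d)).
exists a, b; split => //; first by exact: subset_itv_oo_cc bI.
move: fE gE; rewrite !subr0 !scale0r !add0r => -> /=.
by rewrite addrCA [a *: v + (b *: w + z)]addrCA => ->.
Qed.

Lemma ler_dist_half {R : realFieldType} (x y t e : R) :
  `|x - t| < e / 2 -> `|y - t| < e / 2 -> `|x - y| <= e.
Proof.
move=> xt yt; have -> : x - y = (x - t) - (y - t) by ring.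
by have := ler_normB (x - t) (y - t); lra.
Qed.

(** The second difference is symmetric in [v] and [w], so the two mixed derivatives share a value,
    taken at two possibly different points near [z]. Each is continuous at [z], so their values at
    [z] differ by at most any [e > 0]. *)
Lemma derive_comm {R : realType} {V : normedModType R} {A : set V} (f : V -> R)
    (v w z : V) : open A -> smooth_on A f -> A z ->
  'D_w ('D_v f) z = 'D_v ('D_w f) z.
Proof.
move=> oA sf Az; apply/eqP; rewrite -subr_eq0 -normr_le0;
  apply/ler_addgt0Pl => e e0.
rewrite addr0.
have cont u1 u2 : {for z, continuous ('D_u1 ('D_u2 f))}.
  apply: differentiable_continuous.
  exact: smooth_on_differentiable (smooth_on_derive _ (smooth_on_derive _ sf))
    Az.
have e2 : 0 < e / 2 by rewrite divr_gt0.
have nA : \forall y \near z, A y by exact: open_nbhs_nbhs (conj oA Az).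
have nwv : \forall y \near z, `|'D_w ('D_v f) z - 'D_w ('D_v f) y| < e / 2.
  by have /cvgrPdist_lt /(_ _ e2) := cont w v.
have nvw : \forall y \near z, `|'D_v ('D_w f) z - 'D_v ('D_w f) y| < e / 2.
  by have /cvgrPdist_lt /(_ _ e2) := cont v w.
have [d /= d0 dP] := iffLR (nbhs_ballP _ _) (filterI nA (filterI nwv nvw)).
(* This makes [s * (|v| + |w| + 1)] equal to [d / 2], so the whole parallelogram lies in the ball;
   the summand 1 keeps the denominator positive. *)
pose s := d / (`|v| + `|w| + 1) / 2.
have N0 : 0 < `|v| + `|w| + 1 by rewrite ltr_wpDl // addr_ge0.
have s0 : 0 < s by rewrite !divr_gt0.
have sball a b : 0 <= a <= s -> 0 <= b <= s -> ball z d (a *: v + (b *: w + z)).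
  move=> /andP[a0 as'] /andP[b0 bs].
  rewrite -ball_normE /ball_ /= addrA opprD addrCA subrr addr0 normrN.
  apply: (le_lt_trans (ler_normD _ _)); rewrite !normrZ !ger0_norm //.
  apply: (@le_lt_trans _ _ (s * (`|v| + `|w| + 1))).
    rewrite !mulrDr mulr1 -[leLHS]addr0 lerD ?lerD ?ler_wpM2r //; exact: ltW.
  by rewrite /s mulrAC divfK ?gt_eqF // ltr_pdivrMr // ltr_pMr // ltr1n.
have [a [b [aI bI E1]]] := second_difference sf s0
  (fun a b ha hb => let: conj p _ := dP _ (sball a b ha hb) in p).
have [b' [a' [bI' aI' E2]]] := second_difference (v := w) (w := v) sf s0
  (fun b a hb ha => let: conj p _ := dP _ (eq_ind _ _ (sball a b ha hb) _
    (addrCA _ _ _)) in p).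
have [_ [h1 _]] := dP _ (sball _ _ aI bI).
have [_ [_ h2]] := dP _ (sball _ _ aI' bI').
move: E1 E2; rewrite [s *: w + (s *: v + z)]addrCA => E1 E2.
(* Exchanging the two directions only regroups the second difference; the common factor [s * s] then
   cancels. *)
have swap (x y t u : R) : x - y - (t - u) = x - t - (y - u) by ring.
have /(mulIf (lt0r_neq0 s0)) /(mulIf (lt0r_neq0 s0)) E :=
  etrans (esym E1) (etrans (swap _ _ _ _) E2).
rewrite addrCA -E in h2.
exact: ler_dist_half h1 h2.
Qed.

(** * Partial derivatives and Euler's relation *)

Lemma ord2_cases (i : 'I_2) : i = 0 \/ i = 1.
Proof.
by case: i => [[|[|//]] ltn]; [left|right]; apply: val_inj.
Qed.

Lemma ord2_eqE : ((0 == 0 :> 'I_2) = true) * ((1 == 1 :> 'I_2) = true) *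
  ((0 == 1 :> 'I_2) = false) * ((1 == 0 :> 'I_2) = false).
Proof. by []. Qed.

Lemma sum2E {R : nmodType} (f : 'I_2 -> R) : \sum_i f i = f 0 + f 1.
Proof. by rewrite big_ord_recl big_ord1; congr (_ + f _); apply: val_inj. Qed.

Lemma det2E {R : comRingType} (M : 'M[R]_2) :
  \det M = M 0 0 * M 1 1 - M 0 1 * M 1 0.
Proof.
rewrite (expand_det_row M 0) sum2E /cofactor !det_mx11 !mxE /=.
rewrite expr0 expr1 mul1r mulN1r mulrN.
have l01 : lift (0 : 'I_2) 0 = 1 by apply: val_inj.
have l10 : lift (1 : 'I_2) 0 = 0 by apply: val_inj.
by rewrite l01 l10.
Qed.

(* Locked copies of the partial derivatives: [ring] compares its atoms by
   conversion, which would otherwise unfold the limits defining them. *)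
HB.lock Definition Dx (R : realType) (i : 'I_2)
  (f : 'rV[R]_2 * 'rV[R]_2 -> R) := dx i f.
HB.lock Definition Dy (R : realType) (i : 'I_2)
  (f : 'rV[R]_2 * 'rV[R]_2 -> R) := dy i f.

Section Homogeneous.
Context {R : realType}.
Variable A : set ('rV[R]_2 * 'rV[R]_2).
Hypothesis openA : open A.
Local Notation TV := ('rV[R]_2 * 'rV[R]_2)%type.
Implicit Types (f g : TV -> R) (i j : 'I_2) (r q : R).

(** Homogeneity is encoded by Euler's relation: it is a pointwise condition, so it restricts to
    smaller open sets, and a real degree covers inverses and square roots. *)
Definition euler_hom r f := smooth_on A f /\
  forall z, A z -> ycoord 0 z * Dy 0 f z + ycoord 1 z * Dy 1 f z = r * f z.

Lemma ycoord_linear i : linear (ycoord i : TV -> R).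
Proof. by move=> a u v; rewrite /ycoord !mxE. Qed.

HB.instance Definition _ i :=
  GRing.isLinear.Build R TV R _ (ycoord i : TV -> R) (ycoord_linear i).

Lemma ycoord_continuous i : continuous (ycoord i : TV -> R).
Proof.
move=> z; apply: (@continuous_comp _ _ _ snd (fun y : 'rV[R]_2 => y 0 i)).
  exact: cvg_snd.
exact: coord_continuous.
Qed.

Lemma derive_ycoord i (z v : TV) : 'D_v (ycoord i) z = ycoord i v.
Proof.
rewrite deriveE; last exact/linear_differentiable/ycoord_continuous.
by rewrite diff_lin //; exact: ycoord_continuous.
Qed.

Lemma smooth_on_ycoord i : smooth_on A (ycoord i : TV -> R).
Proof.
apply: (smooth_on_affine openA (df := ycoord i)).
  by move=> z; exact/linear_differentiable/ycoord_continuous.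
by move=> z v; exact: derive_ycoord.
Qed.

Lemma dy_ycoord i j z : Dy i (ycoord j) z = (i == j)%:R :> R.
Proof. by rewrite Dy.unlock /dy derive_ycoord /ycoord mxE eqxx /= eq_sym. Qed.

Lemma dx_ycoord i j z : Dx i (ycoord j) z = 0 :> R.
Proof. by rewrite Dx.unlock /dx derive_ycoord /ycoord mxE. Qed.

Lemma dyD {f g z} i : smooth_on A f -> smooth_on A g -> A z ->
  Dy i (fun z => f z + g z) z = Dy i f z + Dy i g z.
Proof. rewrite Dy.unlock; exact: deriveD_on. Qed.

Lemma dyM {f g z} i : smooth_on A f -> smooth_on A g -> A z ->
  Dy i (fun z => f z * g z) z = f z * Dy i g z + g z * Dy i f z.
Proof. rewrite Dy.unlock; exact: deriveM_on. Qed.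

Lemma dy_cst a i z : Dy i (fun=> a) z = 0 :> R.
Proof. rewrite Dy.unlock; exact: derive_cst. Qed.

Lemma dx_cst a i z : Dx i (fun=> a) z = 0 :> R.
Proof. rewrite Dx.unlock; exact: derive_cst. Qed.

Lemma dxD {f g z} i : smooth_on A f -> smooth_on A g -> A z ->
  Dx i (fun z => f z + g z) z = Dx i f z + Dx i g z.
Proof. rewrite Dx.unlock; exact: deriveD_on. Qed.

Lemma dxM {f g z} i : smooth_on A f -> smooth_on A g -> A z ->
  Dx i (fun z => f z * g z) z = f z * Dx i g z + g z * Dx i f z.
Proof. rewrite Dx.unlock; exact: deriveM_on. Qed.

Lemma dy_ext {f g z} i :
  (forall z, A z -> f z = g z) -> A z -> Dy i f z = Dy i g z.
Proof. rewrite Dy.unlock; exact: derive_ext_on. Qed.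

Lemma dx_ext {f g z} i :
  (forall z, A z -> f z = g z) -> A z -> Dx i f z = Dx i g z.
Proof. rewrite Dx.unlock; exact: derive_ext_on. Qed.

Lemma smooth_on_dy f i : smooth_on A f -> smooth_on A (Dy i f).
Proof. rewrite Dy.unlock; exact: smooth_on_derive. Qed.

Lemma smooth_on_dx f i : smooth_on A f -> smooth_on A (Dx i f).
Proof. rewrite Dx.unlock; exact: smooth_on_derive. Qed.

Lemma dyV {f z} i : smooth_on A f -> A z -> f z != 0 ->
  Dy i (fun z => (f z)^-1) z = - (f z) ^- 2 * Dy i f z.
Proof. rewrite Dy.unlock; exact: deriveV_on. Qed.

Lemma dy_sqrt {f z} i : smooth_on A f -> A z -> 0 < f z ->
  Dy i (fun z => Num.sqrt (f z)) z = (2 * Num.sqrt (f z))^-1 * Dy i f z.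
Proof. rewrite Dy.unlock; exact: derive_sqrt_on. Qed.

Lemma dy_expR {f z} i : smooth_on A f -> A z ->
  Dy i (fun z => expR (f z)) z = expR (f z) * Dy i f z.
Proof. rewrite Dy.unlock; exact: derive_expR_on. Qed.

Lemma dx_expR {f z} i : smooth_on A f -> A z ->
  Dx i (fun z => expR (f z)) z = expR (f z) * Dx i f z.
Proof. rewrite Dx.unlock; exact: derive_expR_on. Qed.

Lemma dy_dy f i j z : smooth_on A f -> A z -> Dy i (Dy j f) z = Dy j (Dy i f) z.
Proof. by move=> sf Az; rewrite Dy.unlock;
  exact: (derive_comm _ _ openA sf Az). Qed.

Lemma dy_dx f i j z : smooth_on A f -> A z -> Dy i (Dx j f) z = Dx j (Dy i f) z.
Proof. by move=> sf Az; rewrite Dy.unlock Dx.unlock;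
  exact: (derive_comm _ _ openA sf Az). Qed.

Lemma euler_hom_ext {r q f g} : euler_hom r f -> r = q ->
  (forall z, A z -> f z = g z) -> euler_hom q g.
Proof.
move=> [sf hf] <- fg; split; first exact: smooth_on_ext fg.
by move=> z Az; rewrite -!(dy_ext _ fg) // -fg // hf.
Qed.

Lemma euler_hom_cst a : euler_hom 0 (fun=> a).
Proof.
split=> [|z _]; first exact: smooth_on_cst.
by rewrite !dy_cst; ring.
Qed.

Lemma euler_hom_ycoord i : euler_hom 1 (ycoord i).
Proof.
split=> [|z _]; first exact: smooth_on_ycoord.
by rewrite !dy_ycoord; case: (ord2_cases i) => ->; rewrite !ord2_eqE /=; ring.
Qed.

Lemma euler_homD {r f g} : euler_hom r f -> euler_hom r g ->
  euler_hom r (fun z => f z + g z).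
Proof.
move=> [sf hf] [sg hg]; split=> [|z Az]; first exact: smooth_onD.
by rewrite !dyD // [RHS]mulrDr -hf // -hg //; ring.
Qed.

Lemma euler_homM {r q f g} : euler_hom r f -> euler_hom q g ->
  euler_hom (r + q) (fun z => f z * g z).
Proof.
move=> [sf hf] [sg hg]; split=> [|z Az]; first exact: smooth_onM.
rewrite !dyM //; have := hf _ Az; have := hg _ Az.
set a := Dy 0 f z; set b := Dy 1 f z; set c := Dy 0 g z; set d := Dy 1 g z.
move: a b c d (f z) (g z) (ycoord 0 z) (ycoord 1 z) => a b c d f' g' y0 y1 hg'
  hf'.
transitivity (f' * (y0 * c + y1 * d) + g' * (y0 * a + y1 * b)); first by ring.
by rewrite hg' hf'; ring.
Qed.

Lemma euler_homV {r f} : euler_hom r f -> (forall z, A z -> f z != 0) ->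
  euler_hom (- r) (fun z => (f z)^-1).
Proof.
move=> [sf hf] f0; split=> [|z Az]; first exact: smooth_onV.
rewrite !(dyV _ sf Az (f0 z Az)).
transitivity (- (f z) ^- 2 * (ycoord 0 z * Dy 0 f z + ycoord 1 z * Dy 1 f z)).
  by ring.
by rewrite hf //; have := f0 _ Az; move: (f z) => a a0; field.
Qed.

Lemma euler_hom_sqrt {r f} : euler_hom r f -> (forall z, A z -> 0 < f z) ->
  euler_hom (r / 2) (fun z => Num.sqrt (f z)).
Proof.
move=> [sf hf] f0; split=> [|z Az]; first exact: smooth_on_sqrt.
rewrite !(dy_sqrt _ sf Az (f0 z Az)).
transitivity ((2 * Num.sqrt (f z))^-1 *
    (ycoord 0 z * Dy 0 f z + ycoord 1 z * Dy 1 f z)).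
  by ring.
rewrite hf // -{2}[f z]sqr_sqrtr ?ltW ?f0 //.
have : Num.sqrt (f z) != 0 by rewrite gt_eqF // sqrtr_gt0 f0.
by move: (Num.sqrt (f z)) => a a0; field.
Qed.

(** Differentiate Euler's relation along y^i: the factor y^i contributes an extra [Dy i f], which
    lowers the degree by one. *)
Lemma euler_hom_dy {r f} i : euler_hom r f -> euler_hom (r - 1) (Dy i f).
Proof.
move=> [sf hf]; split=> [|z Az]; first exact: smooth_on_dy.
have s0 := smooth_on_dy 0 sf; have s1 := smooth_on_dy 1 sf.
have y0 := smooth_on_ycoord 0; have y1 := smooth_on_ycoord 1.
have := dy_ext i hf Az.
rewrite dyD ?dyM ?dy_cst ?dy_ycoord //; try exact: smooth_onM.
  rewrite !(dy_dy i) // => h; apply: (addIr (Dy i f z)).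
  transitivity (r * Dy i f z + f z * 0); last by ring.
  rewrite -h; case: (ord2_cases i) => ->; rewrite !ord2_eqE /=; ring.
exact: smooth_on_cst.
Qed.

(** Here the coefficients y^k are constant along x^i, so differentiating Euler's relation keeps the
    degree. *)
Lemma euler_hom_dx {r f} i : euler_hom r f -> euler_hom r (Dx i f).
Proof.
move=> [sf hf]; split=> [|z Az]; first exact: smooth_on_dx.
have s0 := smooth_on_dy 0 sf; have s1 := smooth_on_dy 1 sf.
have y0 := smooth_on_ycoord 0; have y1 := smooth_on_ycoord 1.
have := dx_ext i hf Az.
rewrite dxD ?dxM ?dx_cst ?dx_ycoord //; try exact: smooth_onM.
  by rewrite !(dy_dx _ i) // !mulr0 !addr0.
exact: smooth_on_cst.
Qed.

End Homogeneous.

(** * The Berwald frame and the geodesic spray *)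

(** Identifies [m_up] and [spray], defined by raising an index, from the linear systems that they
    solve. *)
Lemma invmx_solve {R : fieldType} {n} (M : 'M[R]_n) (w b : 'I_n -> R) :
  M \in unitmx -> (forall i, \sum_j M i j * w j = b i) ->
  forall i, \sum_j invmx M i j * b j = w i.
Proof.
move=> uM Mw i; pose W := \col_j w j.
have MW : M *m W = \col_j b j.
  by apply/colP => k; rewrite !mxE -Mw; apply: eq_bigr => j _; rewrite mxE.
have := congr1 (fun v : 'cV_n => v i 0) (mulKmx uM W).
by rewrite MW !mxE => <-; apply: eq_bigr => j _; rewrite mxE.
Qed.

Lemma mulmx_invmx_sum {R : fieldType} {n} (M : 'M[R]_n) (b : 'I_n -> R) i :
  M \in unitmx -> \sum_j M i j * (\sum_k invmx M j k * b k) = b i.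
Proof.
move=> uM; have := congr1 (fun v : 'cV_n => v i 0) (mulKVmx uM (\col_j b j)).
rewrite !mxE => <-; apply: eq_bigr => j _; rewrite !mxE; congr (_ * _).
by apply: eq_bigr => k _; rewrite mxE.
Qed.

Section Frame.
Context {R : realType} {A : set ('rV[R]_2 * 'rV[R]_2)}.
Hypothesis openA : open A.
Local Notation TV := ('rV[R]_2 * 'rV[R]_2)%type.
Implicit Types (f g : TV -> R) (i j k : 'I_2) (r q : R) (z : TV).

Lemma sqFM f z : f z * f z = sqF f z.
Proof. by rewrite /sqF expr2. Qed.

Lemma smooth_on_sqF f : smooth_on A f -> smooth_on A (sqF f).
Proof.
by move=> sf; apply: smooth_on_ext (smooth_onM openA sf sf) _ => // z _;
  exact: sqFM.
Qed.

Lemma Dy_sqF f i z : smooth_on A f -> A z ->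
  Dy i (sqF f) z = 2 * (f z * Dy i f z).
Proof.
move=> sf Az; rewrite -(dy_ext openA i (fun z _ => sqFM f z) Az) (dyM _ sf sf
  Az).
by ring.
Qed.

Lemma Dx_sqF f i z : smooth_on A f -> A z ->
  Dx i (sqF f) z = 2 * (f z * Dx i f z).
Proof.
move=> sf Az; rewrite -(dx_ext openA i (fun z _ => sqFM f z) Az) (dxM _ sf sf
  Az).
by ring.
Qed.

Lemma gmx_Dy f i j z : gmx f z i j = 2^-1 * Dy i (Dy j (sqF f)) z.
Proof. by rewrite mxE Dy.unlock. Qed.

Lemma gmxE f i j z : smooth_on A f -> A z ->
  gmx f z i j = Dy i f z * Dy j f z + f z * Dy i (Dy j f) z.
Proof.
move=> sf Az; rewrite gmx_Dy.
have sj := smooth_on_dy j sf.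
have sfj := smooth_onM openA sf sj.
rewrite (dy_ext openA i (fun z Az => Dy_sqF j sf Az) Az).
rewrite (dyM i (smooth_on_cst openA 2) sfj Az) dy_cst (dyM i sf sj Az).
by field.
Qed.

Lemma gmx_sym f i j z : smooth_on A f -> A z -> gmx f z i j = gmx f z j i.
Proof.
by move=> sf Az; rewrite !gmx_Dy (dy_dy openA) //; exact: smooth_on_sqF.
Qed.

(** * The frame on an open set of constant signature *)

Context {F Isc : TV -> R} {e : R}.
Hypothesis hF : euler_hom A 1 F.
Hypothesis F0 : forall z, A z -> F z != 0.
Hypothesis gU : forall z, A z -> gmx F z \in unitmx.
Hypothesis epsE : forall z, A z -> eps F z = e.
Hypothesis IscE : is_main_scalar A F Isc.

Let sF : smooth_on A F. Proof. by case: hF. Qed.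

Lemma eps_sqr z : A z -> e * e = 1.
Proof.
move=> Az; rewrite -(epsE Az) -expr2 /eps sqr_sg.
by have := gU Az; rewrite unitmxE unitfE => ->.
Qed.

Lemma euler_hom_l_lo i : euler_hom A 0 (Dy i F).
Proof.
by apply: (euler_hom_ext openA (euler_hom_dy openA i hF)) => //; rewrite subrr.
Qed.

Lemma euler_hom_l_up i : euler_hom A 0 (l_up F i).
Proof.
apply: (euler_hom_ext openA (euler_homM openA (euler_hom_ycoord openA i)
  (euler_homV openA hF F0))) => //.
by rewrite subrr.
Qed.

Lemma euler_hom_g i j : euler_hom A 0 (g_lo F i j).
Proof.
apply: (euler_hom_ext openA (euler_homD openA
  (euler_hom_ext openA (euler_homM openA (euler_hom_l_lo i) (euler_hom_l_lo j))
   (addr0 0) (fun _ _ => erefl))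
  (euler_hom_ext openA
    (euler_homM openA hF (euler_hom_dy openA i (euler_hom_l_lo j)))
   _ (fun _ _ => erefl)))) => //.
  by ring.
by move=> z Az; rewrite /g_lo gmxE.
Qed.

Definition gdet z := g_lo F 0 0 z * g_lo F 1 1 z - g_lo F 0 1 z * g_lo F 1 0 z.

Lemma gdetE z : \det (gmx F z) = gdet z.
Proof. exact: det2E. Qed.

Lemma euler_hom_gdet : euler_hom A 0 gdet.
Proof.
apply: (euler_hom_ext openA (euler_homD openA
  (euler_homM openA (euler_hom_g 0 0) (euler_hom_g 1 1))
  (euler_hom_ext openA (euler_homM openA (euler_hom_cst openA (-1))
    (euler_homM openA (euler_hom_g 0 1) (euler_hom_g 1 0)))
  (add0r _) (fun _ _ => erefl)))) => [|z Az]; first by ring.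
by rewrite mulN1r.
Qed.

(** On [A] the radicand is the absolute value of det g. Using the constant [e] instead of the
    pointwise sign allows differentiation under the root. *)
Definition gvol z := Num.sqrt (e * gdet z).

Lemma edet_gt0 z : A z -> 0 < e * gdet z.
Proof.
move=> Az; rewrite -(epsE Az) /eps gdetE -normrEsg normr_gt0 -gdetE.
by have := gU Az; rewrite unitmxE unitfE.
Qed.

Lemma gvol_gt0 z : A z -> 0 < gvol z.
Proof. by move=> Az; rewrite sqrtr_gt0 edet_gt0. Qed.

Lemma gvol_neq0 z : A z -> gvol z != 0.
Proof. by move=> /gvol_gt0 /lt0r_neq0. Qed.

Lemma gvol_sqr z : A z -> gvol z * gvol z = e * gdet z.
Proof. by move=> Az; rewrite -expr2 sqr_sqrtr // ltW // edet_gt0. Qed.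

Lemma euler_hom_gvol : euler_hom A 0 gvol.
Proof.
apply: (euler_hom_ext openA (euler_hom_sqrt openA (euler_homM openA
  (euler_hom_cst openA e) euler_hom_gdet) edet_gt0)) => //.
by ring.
Qed.

Lemma m_lo0E z : A z -> m_lo F 0 z = - gvol z * l_up F 1 z.
Proof. by move=> Az; rewrite /m_lo eqxx (epsE Az) gdetE. Qed.

Lemma m_lo1E z : A z -> m_lo F 1 z = gvol z * l_up F 0 z.
Proof. by move=> Az; rewrite /m_lo (epsE Az) gdetE. Qed.

Lemma l_up_l_lo z : A z -> l_up F 0 z * Dy 0 F z + l_up F 1 z * Dy 1 F z = 1.
Proof.
move=> Az; have [_ /(_ z Az) h] := hF.
transitivity ((ycoord 0 z * Dy 0 F z + ycoord 1 z * Dy 1 F z) / F z).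
  by rewrite /l_up; ring.
by rewrite h mul1r divff // F0.
Qed.

(** In [gmxE] the Hessian term contracts to 0 with y, since [Dy i F] is homogeneous of degree 0; the
    other term uses l^j l_j = 1. *)
Lemma g_l_up z i : A z ->
  gmx F z i 0 * l_up F 0 z + gmx F z i 1 * l_up F 1 z = Dy i F z.
Proof.
move=> Az; have [_ /(_ z Az) h] := euler_hom_dy openA i hF.
rewrite !gmxE // !(dy_dy openA i) //.
transitivity (Dy i F z * (l_up F 0 z * Dy 0 F z + l_up F 1 z * Dy 1 F z)
  + F z * ((ycoord 0 z * Dy 0 (Dy i F) z + ycoord 1 z * Dy 1 (Dy i F) z) / F
    z)).
  by rewrite /l_up; ring.
by rewrite l_up_l_lo // h subrr; ring.
Qed.

(** Substitute l_i = g_ij l^j. For symmetric g, the difference g_ij g(l,l) - l_i l_j is det g times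
    the product of components i and j of (-l^2, l^1). The claim follows from g(l,l) = 1 and
    [e * gvol ^+ 2] = det g. *)
Lemma gE z i j : A z ->
  gmx F z i j = Dy i F z * Dy j F z + e * m_lo F i z * m_lo F j z.
Proof.
move=> Az.
have ee := eps_sqr Az; have ll := l_up_l_lo Az.
have h0 := g_l_up 0 Az; have h1 := g_l_up 1 Az.
have h10 := gmx_sym 1 0 sF Az; rewrite h10 in h1.
have S : e * (gvol z * gvol z) =
    gmx F z 0 0 * gmx F z 1 1 - gmx F z 0 1 * gmx F z 0 1.
  by rewrite gvol_sqr // mulrA ee mul1r /gdet /g_lo h10.
case: (ord2_cases i) => ->; case: (ord2_cases j) => ->;
  rewrite ?h10 ?m_lo0E ?m_lo1E // -?h0 -?h1; move: ll; rewrite -h0 -h1;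
  move: (gvol z) (l_up F 0 z) (l_up F 1 z) (gmx F z 0 0) (gmx F z 0 1)
    (gmx F z 1 1) S => s l0 l1 a b c S ll;
  rewrite -[LHS]mulr1 -ll.
- by transitivity (e * (s * s) * (l1 * l1) + (a * l0 + b * l1) ^+ 2);
    [rewrite S|]; ring.
- by transitivity (- (e * (s * s)) * (l0 * l1) +
    (a * l0 + b * l1) * (b * l0 + c * l1)); [rewrite S|]; ring.
- by transitivity (- (e * (s * s)) * (l0 * l1) +
    (a * l0 + b * l1) * (b * l0 + c * l1)); [rewrite S|]; ring.
- by transitivity (e * (s * s) * (l0 * l0) + (b * l0 + c * l1) ^+ 2);
    [rewrite S|]; ring.
Qed.

(** Being annihilated by l_i, the vector m^i is proportional to (-l_2, l_1); m^i m_i = e fixes the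
    factor. This explicit form can be differentiated, unlike the one through [invmx]. *)
Lemma m_upE z i : A z ->
  m_up F i z = (if i == 0 then - e * Dy 1 F z else e * Dy 0 F z) / gvol z.
Proof.
move=> Az; apply: (invmx_solve (w := fun i : 'I_2 =>
  (if i == 0 then - e * Dy 1 F z else e * Dy 0 F z) / gvol z)); first exact: gU.
move=> k; rewrite sum2E !ord2_eqE !gE //.
have ee := eps_sqr Az; have ll := l_up_l_lo Az.
rewrite m_lo0E // m_lo1E //; move: (m_lo F k z) => mk.
have := gvol_neq0 Az.
move: (gvol z) (l_up F 0 z) (l_up F 1 z) (Dy 0 F z) (Dy 1 F z) (Dy k F z) ll.
move=> s l0 l1 L0 L1 Lk ll s0.
transitivity (e * e * mk * (l0 * L0 + l1 * L1)); first by field.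
by rewrite ee ll; ring.
Qed.

Lemma m_up0E z : A z -> m_up F 0 z = - e * Dy 1 F z / gvol z.
Proof. exact: m_upE. Qed.

Lemma m_up1E z : A z -> m_up F 1 z = e * Dy 0 F z / gvol z.
Proof. exact: m_upE. Qed.

(* Contract [w] with delta^i_j = l^i l_j + e m^i m_j. *)
Lemma coframe (w : 'I_2 -> R) z j : A z ->
  w j = (w 0 * l_up F 0 z + w 1 * l_up F 1 z) * Dy j F z
    + e * (w 0 * m_up F 0 z + w 1 * m_up F 1 z) * m_lo F j z.
Proof.
move=> Az; have ee := eps_sqr Az; have ll := l_up_l_lo Az.
have s0 := gvol_neq0 Az; rewrite m_up0E // m_up1E //.
case: (ord2_cases j) => ->; rewrite ?m_lo0E ?m_lo1E //; move: (w 0) (w 1) s0 ll.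
all: move: (gvol z) (l_up F 0 z) (l_up F 1 z) (Dy 0 F z) (Dy 1 F z).
all: move=> s l0 l1 L0 L1 w0 w1 s0 ll.
- transitivity (w0 * (l0 * L0 + l1 * L1)); first by rewrite ll mulr1.
  transitivity ((w0 * l0 + w1 * l1) * L0 + e * e * (w0 * L1 - w1 * L0) * l1).
    by rewrite ee; ring.
  by field.
- transitivity (w1 * (l0 * L0 + l1 * L1)); first by rewrite ll mulr1.
  transitivity ((w0 * l0 + w1 * l1) * L1 - e * e * (w0 * L1 - w1 * L0) * l0).
    by rewrite ee; ring.
  by field.
Qed.

Lemma v2E f z : A z ->
  v2 F f z = e * F z * (Dy 0 f z * m_up F 0 z + Dy 1 f z * m_up F 1 z).
Proof. by move=> Az; rewrite /v2 (epsE Az) sum2E Dy.unlock. Qed.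

(** Apply [coframe] to the vertical gradient of [f]: its component along l_j is given by Euler's
    relation, the one along m_j is [v2] by definition. *)
Lemma Dy_frame r f j z : euler_hom A r f -> A z ->
  F z * Dy j f z = r * f z * Dy j F z + v2 F f z * m_lo F j z.
Proof.
move=> [_ hf] Az; rewrite (coframe (fun j => Dy j f z) j Az) v2E //.
rewrite -hf //; have := F0 Az; rewrite /l_up.
by move: (F z) (ycoord 0 z) (ycoord 1 z) => ? ? ? ?; field.
Qed.

Lemma euler_hom_m_lo i : euler_hom A 0 (m_lo F i).
Proof.
case: (ord2_cases i) => ->.
- apply: (euler_hom_ext openA (euler_homM openA (euler_hom_cst openA (-1))
    (euler_homM openA euler_hom_gvol (euler_hom_l_up 1)))) => [|z Az].
    by ring.
  by rewrite m_lo0E // mulN1r mulNr.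
- apply: (euler_hom_ext openA
    (euler_homM openA euler_hom_gvol (euler_hom_l_up 0))) => [|z Az].
    by ring.
  by rewrite m_lo1E.
Qed.

Lemma euler_hom_m_up i : euler_hom A 0 (m_up F i).
Proof.
case: (ord2_cases i) => ->.
- apply: (euler_hom_ext openA (euler_homM openA (euler_hom_cst openA (- e))
    (euler_homM openA (euler_hom_l_lo 1)
      (euler_homV openA euler_hom_gvol gvol_neq0)))) => [|z Az].
    by ring.
  by rewrite m_up0E // mulrA.
- apply: (euler_hom_ext openA (euler_homM openA (euler_hom_cst openA e)
    (euler_homM openA (euler_hom_l_lo 0)
      (euler_homV openA euler_hom_gvol gvol_neq0)))) => [|z Az].
    by ring.
  by rewrite m_up1E // mulrA.
Qed.

Lemma euler_hom_v2 r f : euler_hom A r f -> euler_hom A r (v2 F f).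
Proof.
move=> hf; apply: (euler_hom_ext openA (euler_homM openA
  (euler_homM openA (euler_hom_cst openA e) hF) (euler_homD openA
    (euler_homM openA (euler_hom_dy openA 0 hf) (euler_hom_m_up 0))
    (euler_homM openA (euler_hom_dy openA 1 hf) (euler_hom_m_up 1))))).
  by ring.
by move=> z Az; rewrite v2E.
Qed.

(** * Vertical derivatives of the frame *)

(** Both [gmxE] and [gE] write g_kj as l_k l_j plus a remainder, and the remainders must agree. *)
Lemma Dy_l_lo k j z : A z ->
  F z * Dy k (Dy j F) z = e * m_lo F k z * m_lo F j z.
Proof.
move=> Az; have := gE k j Az; rewrite gmxE //.
by move/addrI.
Qed.

Lemma Dy_l_up k i z : A z ->
  F z * Dy k (l_up F i) z = e * m_up F i z * m_lo F k z.
Proof.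
move=> Az; have := dyM k (smooth_on_ycoord openA i) (smooth_onV openA sF F0) Az.
rewrite dy_ycoord (dyV k sF Az (F0 Az)) -/(l_up F i) => ->.
(* For a Kronecker vector [coframe] is the completeness relation delta^i_k = l^i l_k + e m^i m_k;
   the quotient rule leaves delta^i_k - l^i l_k. *)
have := coframe (fun j => (j == i)%:R) k Az; rewrite /l_up.
have := F0 Az; move: (Dy k F z) (m_lo F k z) (F z) => Lk mk a a0.
case: (ord2_cases i) => ->; rewrite !ord2_eqE /= ?mulr1n ?mulr0n => E.
- transitivity ((k == 0)%:R - ycoord 0 z / a * Lk); first by field.
  by rewrite E; ring.
- transitivity ((k == 1)%:R - ycoord 1 z / a * Lk); first by field.
  by rewrite E; ring.
Qed.

Lemma Dy_g k i j z : A z ->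
  F z * Dy k (g_lo F i j) z = 2 * Isc z * m_lo F i z * m_lo F j z * m_lo F k z.
Proof.
move=> Az; have := IscE Az i j k.
have -> : cartan F i j k z = 2^-1 * Dy k (g_lo F i j) z by rewrite Dy.unlock.
move: (F z) (Isc z) (Dy _ _ _) => a b d E.
transitivity (2 * (a * (2^-1 * d))); first by field.
by rewrite E; ring.
Qed.

Lemma smooth_g i j : smooth_on A (g_lo F i j).
Proof. by case: (euler_hom_g i j). Qed.

(** The logarithmic derivative of det g is the trace g^ij d'_k g_ij, which is 2 e I m_k / F. The
    computation avoids the inverse matrix through det g = e (l_1 m_2 - l_2 m_1)^2. *)
Lemma Dy_gdet k z : A z -> F z * Dy k gdet z = 2 * e * Isc z * gdet z * m_lo F k
  z.
Proof.
move=> Az; have sg := smooth_g.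
have DE : Dy k gdet z = g_lo F 0 0 z * Dy k (g_lo F 1 1) z
    + g_lo F 1 1 z * Dy k (g_lo F 0 0) z - g_lo F 0 1 z * Dy k (g_lo F 1 0) z
    - g_lo F 1 0 z * Dy k (g_lo F 0 1) z.
  transitivity (Dy k (fun z => g_lo F 0 0 z * g_lo F 1 1 z +
      -1 * (g_lo F 0 1 z * g_lo F 1 0 z)) z).
    by apply: (dy_ext openA) => // z' _; rewrite /gdet mulN1r.
  have s1 := smooth_onM openA (sg 0 0) (sg 1 1).
  have s2 := smooth_onM openA (sg 0 1) (sg 1 0).
  have sN := smooth_on_cst openA (-1 : R).
  rewrite (dyD k s1 (smooth_onM openA sN s2) Az) (dyM k sN s2 Az).
  rewrite (dyM k (sg 0 0) (sg 1 1) Az) (dyM k (sg 0 1) (sg 1 0) Az) dy_cst.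
  by ring.
have ee := eps_sqr Az.
transitivity (g_lo F 0 0 z * (F z * Dy k (g_lo F 1 1) z)
    + g_lo F 1 1 z * (F z * Dy k (g_lo F 0 0) z)
    - g_lo F 0 1 z * (F z * Dy k (g_lo F 1 0) z)
    - g_lo F 1 0 z * (F z * Dy k (g_lo F 0 1) z)); first by rewrite DE; ring.
have Eg : gdet z = e * (Dy 0 F z * m_lo F 1 z - Dy 1 F z * m_lo F 0 z) ^+ 2.
  by rewrite /gdet /g_lo !gE //; ring.
transitivity (2 * (e * e) * Isc z *
    (Dy 0 F z * m_lo F 1 z - Dy 1 F z * m_lo F 0 z) ^+ 2 * m_lo F k z).
  by rewrite !Dy_g // /g_lo !gE // ee; ring.
by rewrite Eg; ring.
Qed.

Lemma smooth_gvol : smooth_on A gvol.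
Proof. by case: euler_hom_gvol. Qed.

Lemma Dy_gvol k z : A z -> F z * Dy k gvol z = e * Isc z * gvol z * m_lo F k z.
Proof.
move=> Az; have [sg _] := euler_hom_gdet.
have sE := smooth_on_cst openA e.
have -> : Dy k gvol z = (2 * gvol z)^-1 * (e * Dy k gdet z).
  transitivity ((2 * gvol z)^-1 * Dy k (fun z => e * gdet z) z).
    exact: dy_sqrt (smooth_onM openA sE sg) Az (edet_gt0 Az).
  by rewrite (dyM k sE sg Az) dy_cst mulr0 addr0.
have := Dy_gdet k Az; have := gvol_sqr Az; have := gvol_neq0 Az.
move: (gvol z) (gdet z) (Dy k gdet z) (F z) (Isc z) (m_lo F k z).
move=> s g d a b m s0 S E.
transitivity (e * (a * d) / (2 * s)); first by field.
rewrite E; transitivity (e * b * m * (e * g) / s); first by field.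
by rewrite -S; field.
Qed.

Lemma Dy_m_lo k j z : A z ->
  F z * Dy k (m_lo F j) z =
    (e * Isc z * m_lo F j z - Dy j F z) * m_lo F k z.
Proof.
move=> Az; have ss := smooth_gvol; have [sl0 _] := euler_hom_l_up 0.
have [sl1 _] := euler_hom_l_up 1.
have sN := smooth_on_cst openA (-1 : R).
have Es := Dy_gvol k Az; have s0 := gvol_neq0 Az.
have E0 := Dy_l_up k 0 Az; have E1 := Dy_l_up k 1 Az.
have ee := eps_sqr Az.
case: (ord2_cases j) => ->.
- have -> : Dy k (m_lo F 0) z = - (gvol z * Dy k (l_up F 1) z + l_up F 1 z * Dy
  k gvol z).
    transitivity (Dy k (fun z => -1 * (gvol z * l_up F 1 z)) z).
      by apply: (dy_ext openA) => // z' Az'; rewrite m_lo0E // mulN1r mulNr.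
    rewrite (dyM k sN (smooth_onM openA ss sl1) Az) dy_cst (dyM k ss sl1 Az).
    by ring.
  transitivity (- (gvol z * (F z * Dy k (l_up F 1) z)
    + l_up F 1 z * (F z * Dy k gvol z))); first by ring.
  rewrite E1 Es m_up1E // m_lo0E //; move: s0.
  move: (gvol z) (Dy 0 F z) (l_up F 1 z) (m_lo F k z) (Isc z) => s L l m I s0.
  transitivity (- (e * e) * L * m - e * I * s * l * m); first by field.
  by rewrite ee; ring.
- have -> : Dy k (m_lo F 1) z = gvol z * Dy k (l_up F 0) z + l_up F 0 z * Dy k
  gvol z.
    transitivity (Dy k (fun z => gvol z * l_up F 0 z) z).
      by apply: (dy_ext openA) => // z' Az'; rewrite m_lo1E.
    by rewrite (dyM k ss sl0 Az).
  transitivity (gvol z * (F z * Dy k (l_up F 0) z)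
    + l_up F 0 z * (F z * Dy k gvol z)); first by ring.
  rewrite E0 Es m_up0E // m_lo1E //; move: s0.
  move: (gvol z) (Dy 1 F z) (l_up F 0 z) (m_lo F k z) (Isc z) => s L l m I s0.
  transitivity (- (e * e) * L * m + e * I * s * l * m); first by field.
  by rewrite ee; ring.
Qed.

Lemma Dy_m_up k i z : A z ->
  F z * Dy k (m_up F i) z = - (l_up F i z + e * Isc z * m_up F i z) * m_lo F k
    z.
Proof.
move=> Az; have ss := smooth_gvol; have [sL0 _] := euler_hom_l_lo 0.
have [sL1 _] := euler_hom_l_lo 1.
have sV := smooth_onV openA ss gvol_neq0.
have Es := Dy_gvol k Az; have s0 := gvol_neq0 Az.
have ee := eps_sqr Az.
(* Both components of m^i have the form c l_j / [gvol], with c = -e, j = 1 or c = e, j = 0. *)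
have main j c : smooth_on A (Dy j F) ->
    F z * Dy k (fun z => c * (Dy j F z * (gvol z)^-1)) z =
    c * e * (m_lo F j z / gvol z - Isc z * Dy j F z / gvol z) * m_lo F k z.
  move=> sL; have sc := smooth_on_cst openA c.
  rewrite (dyM k sc (smooth_onM openA sL sV) Az) dy_cst (dyM k sL sV Az).
  rewrite (dyV k ss Az s0).
  transitivity (c * (F z * Dy k (Dy j F) z) / gvol z
      - c * Dy j F z * (F z * Dy k gvol z) / gvol z ^+ 2).
    by move: s0; move: (gvol z) => s s0; field.
  rewrite Dy_l_lo // Es; move: s0; move: (gvol z) => s s0; field.
  exact: s0.
case: (ord2_cases i) => ->.
- rewrite [X in F z * X](dy_ext openA k (g := fun z => - e * (Dy 1 F z * (gvol
  z)^-1)) _ Az); last first.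
    by move=> z' Az'; rewrite m_up0E // mulrA.
  rewrite main // m_up0E // m_lo1E //; move: s0.
  move: (gvol z) (Dy 1 F z) (l_up F 0 z) (m_lo F k z) (Isc z) => s L l m I s0.
  transitivity (- (e * e) * l * m + (e * e) * I * L / s * m); first by field.
  by rewrite {1}ee; field.
- rewrite [X in F z * X](dy_ext openA k (g := fun z => e * (Dy 0 F z * (gvol
  z)^-1)) _ Az); last first.
    by move=> z' Az'; rewrite m_up1E // mulrA.
  rewrite main // m_up1E // m_lo0E //; move: s0.
  move: (gvol z) (Dy 0 F z) (l_up F 1 z) (m_lo F k z) (Isc z) => s L l m I s0.
  transitivity (- (e * e) * l * m - (e * e) * I * L / s * m); first by field.
  by rewrite {1}ee; field.
Qed.

Lemma m_lo_m_up z : A z -> m_lo F 0 z * m_up F 0 z + m_lo F 1 z * m_up F 1 z =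
  e.
Proof.
move=> Az; have ll := l_up_l_lo Az; have s0 := gvol_neq0 Az.
rewrite m_lo0E // m_lo1E // m_up0E // m_up1E //.
transitivity (e * (l_up F 0 z * Dy 0 F z + l_up F 1 z * Dy 1 F z)).
  by move: s0; move: (gvol z) => s s0; field.
by rewrite ll mulr1.
Qed.

(** [is_main_scalar] is a pointwise equation; smoothness and degree of [Isc] are recovered by
    contracting [Dy_gvol] with m^k, which expresses [Isc] through [gvol] and the frame. *)
Lemma euler_hom_main_scalar : euler_hom A 0 Isc.
Proof.
apply: (euler_hom_ext openA (euler_homM openA (euler_homM openA hF
  (euler_homV openA euler_hom_gvol gvol_neq0)) (euler_homD openA
    (euler_homM openA (euler_hom_dy openA 0 euler_hom_gvol) (euler_hom_m_up 0))
    (euler_homM openA (euler_hom_dy openA 1 euler_hom_gvol) (euler_hom_m_up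
      1)))))
  => [|z Az]; first by ring.
have s0 := gvol_neq0 Az.
transitivity (((F z * Dy 0 gvol z) * m_up F 0 z + (F z * Dy 1 gvol z) * m_up F 1
  z)
  / gvol z); first by ring.
rewrite !Dy_gvol //.
transitivity (e * Isc z * (m_lo F 0 z * m_up F 0 z + m_lo F 1 z * m_up F 1 z)).
  by move: s0; move: (gvol z) => s s0; field.
by rewrite m_lo_m_up // mulrAC (eps_sqr Az) mul1r.
Qed.

Lemma l_up_m_lo z : A z -> l_up F 0 z * m_lo F 0 z + l_up F 1 z * m_lo F 1 z =
  0.
Proof. by move=> Az; rewrite m_lo0E // m_lo1E //; ring. Qed.

Lemma l_lo_m_up z : A z -> Dy 0 F z * m_up F 0 z + Dy 1 F z * m_up F 1 z = 0.
Proof. by move=> Az; rewrite m_up0E // m_up1E //; ring. Qed.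

(* [spray_cov f] is y^k d'_j d_k f - d_j f, so that the spray of f is
   g^{ij} (spray_cov (f^2))_j / 4. *)
Definition spray_cov f j z : R :=
  ycoord 0 z * Dy j (Dx 0 f) z + ycoord 1 z * Dy j (Dx 1 f) z - Dx j f z.

Lemma sprayE f i z : spray f i z =
  \sum_j g_up f i j z * (4^-1 * spray_cov (sqF f) j z).
Proof.
rewrite /spray mulr_sumr; apply: eq_bigr => j _.
by rewrite mulrCA; congr (_ * (_ * _));
  rewrite sum2E /spray_cov Dy.unlock Dx.unlock.
Qed.

Lemma spray_solve f (w : 'I_2 -> R) z : gmx f z \in unitmx ->
  (forall j, 4 * (gmx f z j 0 * w 0 + gmx f z j 1 * w 1) =
    spray_cov (sqF f) j z) -> forall i, spray f i z = w i.
Proof.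
move=> uf fw i; rewrite sprayE; apply: (invmx_solve (w := w)) => // j.
by rewrite sum2E -fw; field.
Qed.

Lemma spray_eq f j z : gmx f z \in unitmx ->
  4 * (gmx f z j 0 * spray f 0 z + gmx f z j 1 * spray f 1 z) =
    spray_cov (sqF f) j z.
Proof.
move=> uf; have := mulmx_invmx_sum (fun j => 4^-1 * spray_cov (sqF f) j z) j uf.
by rewrite sum2E -!sprayE => ->; field.
Qed.

Lemma euler_hom_sqF : euler_hom A 2 (sqF F).
Proof.
apply: (euler_hom_ext openA (euler_homM openA hF hF)) => [|z _]; first by ring.
exact: sqFM.
Qed.

Lemma euler_hom_spray_cov j : euler_hom A 2 (spray_cov (sqF F) j).
Proof.
have h k : euler_hom A 2 (fun z => ycoord k z * Dy j (Dx k (sqF F)) z).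
  apply: (euler_hom_ext openA (euler_homM openA (euler_hom_ycoord openA k)
    (euler_hom_dy openA j (euler_hom_dx openA k euler_hom_sqF)))) => //.
  by ring.
apply: (euler_hom_ext openA (euler_homD openA (euler_homD openA (h 0) (h 1))
  (euler_hom_ext openA (euler_homM openA (euler_hom_cst openA (-1))
    (euler_hom_dx openA j euler_hom_sqF)) (add0r _) (fun _ _ => erefl)))) => //.
by move=> z _; rewrite mulN1r.
Qed.

Lemma gdet_neq0 z : A z -> gdet z != 0.
Proof. by move=> Az; have := gU Az; rewrite -gdetE unitmxE unitfE. Qed.

(** Cramer's rule makes the spray a rational expression in smooth homogeneous functions, from which
    [euler_hom_spray] follows. Subtractions are written with [-1 *] to match the closure rules. *)
Lemma spray_cramer i z : A z -> spray F i z =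
  (if i == 0 then g_lo F 1 1 z * spray_cov (sqF F) 0 z
                  + -1 * (g_lo F 0 1 z * spray_cov (sqF F) 1 z)
   else g_lo F 0 0 z * spray_cov (sqF F) 1 z
        + -1 * (g_lo F 1 0 z * spray_cov (sqF F) 0 z)) * (4^-1 * (gdet z)^-1).
Proof.
move=> Az; apply: (spray_solve (w := fun i : 'I_2 =>
  (if i == 0 then g_lo F 1 1 z * spray_cov (sqF F) 0 z
                  + -1 * (g_lo F 0 1 z * spray_cov (sqF F) 1 z)
   else g_lo F 0 0 z * spray_cov (sqF F) 1 z
        + -1 * (g_lo F 1 0 z * spray_cov (sqF F) 0 z)) * (4^-1 * (gdet z)^-1))).
  exact: gU.
move=> j; rewrite !ord2_eqE; have := gdet_neq0 Az; rewrite /gdet /g_lo.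
case: (ord2_cases j) => ->;
  move: (spray_cov _ 0 z) (spray_cov _ 1 z) (gmx F z 0 0) (gmx F z 0 1)
    (gmx F z 1 0) (gmx F z 1 1) => X0 X1 a b c d D0; field; exact: D0.
Qed.

Lemma euler_hom_spray i : euler_hom A 2 (spray F i).
Proof.
have hX := euler_hom_spray_cov.
have h a b c d j k l : euler_hom A 2 (fun z =>
    (g_lo F a b z * spray_cov (sqF F) j z +
     -1 * (g_lo F c d z * spray_cov (sqF F) k z)) * (l * (gdet z)^-1)).
  apply: (euler_hom_ext openA (euler_homM openA (euler_homD openA
    (euler_homM openA (euler_hom_g a b) (hX j))
    (euler_hom_ext openA (euler_homM openA (euler_hom_cst openA (-1))
      (euler_homM openA (euler_hom_g c d) (hX k)))
      (add0r _) (fun _ _ => erefl)))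
    (euler_homM openA (euler_hom_cst openA l)
      (euler_homV openA euler_hom_gdet gdet_neq0)))) => //.
  by ring.
case: (ord2_cases i) => ->.
  by apply: (euler_hom_ext openA (h 1 1 0 1 0 1 4^-1)) => // z Az;
    rewrite spray_cramer.
by apply: (euler_hom_ext openA (h 0 0 1 0 1 0 4^-1)) => // z Az;
  rewrite spray_cramer.
Qed.

Lemma smooth_on_spray i : smooth_on A (spray F i).
Proof. by case: (euler_hom_spray i). Qed.

(** * Horizontal derivatives *)

Lemma deltaE f i z : delta F i f z = Dx i f z +
  -1 * (Dy i (spray F 0) z * Dy 0 f z + Dy i (spray F 1) z * Dy 1 f z).
Proof. by rewrite /delta sum2E /barthel Dy.unlock Dx.unlock mulN1r. Qed.

Lemma euler_hom_delta r f i : euler_hom A r f -> euler_hom A r (delta F i f).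
Proof.
move=> hf.
have h k : euler_hom A r (fun z => Dy i (spray F k) z * Dy k f z).
  apply: (euler_hom_ext openA (euler_homM openA
    (euler_hom_dy openA i (euler_hom_spray k)) (euler_hom_dy openA k hf))) =>
      //.
  by ring.
apply: (euler_hom_ext openA (euler_homD openA (euler_hom_dx openA i hf)
  (euler_hom_ext openA (euler_homM openA (euler_hom_cst openA (-1))
    (euler_homD openA (h 0) (h 1))) (add0r _) (fun _ _ => erefl)))) => //.
by move=> z _; rewrite deltaE.
Qed.

(* The geodesic spray y^k d_k - 2 G^k d'_k, as a derivation. *)
Definition spray_field f z : R :=
  ycoord 0 z * Dx 0 f z + ycoord 1 z * Dx 1 f z +
  - 2 * (spray F 0 z * Dy 0 f z + spray F 1 z * Dy 1 f z).

(** In d'_j (S f), differentiating the coefficients y^k and G^k yields d_j f - 2 G^k_j d'_k f, that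
    is, 2 delta_j f - d_j f. *)
Lemma spray_cov_delta f j z : smooth_on A f -> A z ->
  spray_cov f j z = Dy j (spray_field f) z - 2 * delta F j f z
    + 2 * (spray F 0 z * Dy j (Dy 0 f) z + spray F 1 z * Dy j (Dy 1 f) z).
Proof.
move=> sf Az.
have sy k := smooth_on_ycoord openA k; have sx k := smooth_on_dx k sf.
have sd k := smooth_on_dy k sf; have sG := smooth_on_spray.
have syx k := smooth_onM openA (sy k) (sx k).
have sGd k := smooth_onM openA (sG k) (sd k).
have s2 := smooth_on_cst openA (- 2 : R).
have sG2 := smooth_onD openA (sGd 0) (sGd 1).
have -> : Dy j (spray_field f) z =
    ycoord 0 z * Dy j (Dx 0 f) z + Dx 0 f z * (j == 0)%:R +
    (ycoord 1 z * Dy j (Dx 1 f) z + Dx 1 f z * (j == 1)%:R) +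
    - 2 * (spray F 0 z * Dy j (Dy 0 f) z + Dy 0 f z * Dy j (spray F 0) z +
           (spray F 1 z * Dy j (Dy 1 f) z + Dy 1 f z * Dy j (spray F 1) z)).
  transitivity (Dy j (fun z => ycoord 0 z * Dx 0 f z + ycoord 1 z * Dx 1 f z) z
    + Dy j (fun z => - 2 * (spray F 0 z * Dy 0 f z + spray F 1 z * Dy 1 f z))
      z).
    exact: dyD (smooth_onD openA (syx 0) (syx 1)) (smooth_onM openA s2 sG2) Az.
  rewrite (dyD j (syx 0) (syx 1) Az) (dyM j (sy 0) (sx 0) Az).
  rewrite (dyM j (sy 1) (sx 1) Az) !dy_ycoord (dyM j s2 sG2 Az) dy_cst.
  rewrite (dyD j (sGd 0) (sGd 1) Az) (dyM j (sG 0) (sd 0) Az).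
  by rewrite (dyM j (sG 1) (sd 1) Az); ring.
rewrite deltaE /spray_cov.
by case: (ord2_cases j) => ->; rewrite !ord2_eqE /= ?mulr1n ?mulr0n; ring.
Qed.

Lemma smooth_on_sqFF : smooth_on A (sqF F).
Proof. exact: smooth_on_sqF. Qed.

(** F^2 is constant along geodesics. Contract the geodesic equation with y^j: one side becomes 2 G^k
    d'_k F^2, and on the other Euler's relation for d_k F^2, of degree 2, leaves y^k d_k F^2. *)
Lemma spray_field_sqF z : A z -> spray_field (sqF F) z = 0.
Proof.
move=> Az; have c0 := spray_eq 0 (gU Az); have c1 := spray_eq 1 (gU Az).
have [_ /(_ z Az) h0] := euler_hom_dx openA 0 euler_hom_sqF.
have [_ /(_ z Az) h1] := euler_hom_dx openA 1 euler_hom_sqF.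
have y_l k : ycoord k z = F z * l_up F k z.
  by rewrite /l_up mulrC divfK // F0.
have g0 := g_l_up 0 Az; have g1 := g_l_up 1 Az.
have g01 := gmx_sym 0 1 sF Az.
have E : 2 * (spray F 0 z * Dy 0 (sqF F) z + spray F 1 z * Dy 1 (sqF F) z) =
    ycoord 0 z * spray_cov (sqF F) 0 z + ycoord 1 z * spray_cov (sqF F) 1 z.
  rewrite -c0 -c1 !Dy_sqF // -g0 -g1 !y_l g01.
  by ring.
rewrite /spray_field mulNr E /spray_cov.
move: h0 h1; move: (Dy 0 (Dx 0 _) z) (Dy 1 (Dx 0 _) z) (Dy 0 (Dx 1 _) z).
move: (Dy 1 (Dx 1 _) z) (Dx 0 _ z) (Dx 1 _ z) (ycoord 0 z) (ycoord 1 z).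
move=> p11 X0 X1 y0 y1 p00 p10 p01 h0 h1.
transitivity (y0 * (2 * X0) + y1 * (2 * X1) - y0 * (y0 * p00 + y1 * p10)
  - y1 * (y0 * p01 + y1 * p11)); first by ring.
by rewrite h0 h1; ring.
Qed.

Lemma gmx_Dy_sqF j z : A z ->
  spray F 0 z * Dy j (Dy 0 (sqF F)) z + spray F 1 z * Dy j (Dy 1 (sqF F)) z =
  2^-1 * spray_cov (sqF F) j z.
Proof.
by move=> Az; rewrite -(spray_eq j (gU Az)) !gmx_Dy; field.
Qed.

(** In [spray_cov_delta] for F^2 the first term vanishes by [spray_field_sqF], and the last one
    equals the left-hand side by the geodesic equation. *)
Lemma delta_sqF j z : A z -> delta F j (sqF F) z = 0.
Proof.
move=> Az; have := spray_cov_delta j smooth_on_sqFF Az.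
rewrite gmx_Dy_sqF // (dy_ext openA j spray_field_sqF Az) dy_cst.
move: (delta _ _ _ _) (spray_cov _ _ _) => d x E.
transitivity (2^-1 * (x - (x - 2 * d))); first by field.
by rewrite {1}E; field.
Qed.

Lemma h1E f z : h1 F f z = delta F 0 f z * l_up F 0 z + delta F 1 f z * l_up F 1
  z.
Proof. by rewrite /h1 sum2E. Qed.

Lemma h2E f z : A z ->
  h2 F f z = e * (delta F 0 f z * m_up F 0 z + delta F 1 f z * m_up F 1 z).
Proof. by move=> Az; rewrite /h2 (epsE Az) sum2E. Qed.

Lemma delta_frame f j z : A z ->
  delta F j f z = h1 F f z * Dy j F z + h2 F f z * m_lo F j z.
Proof.
by move=> Az; rewrite h1E h2E //; exact: (coframe (fun j => delta F j f z)).
Qed.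

(** G^k has degree 2, so y^j G^k_j = 2 G^k and y^j delta_j is the geodesic spray. *)
Lemma spray_field_h1 f z : A z -> spray_field f z = F z * h1 F f z.
Proof.
move=> Az; rewrite h1E !deltaE /spray_field.
have [_ /(_ z Az) e0] := euler_hom_spray 0.
have [_ /(_ z Az) e1] := euler_hom_spray 1.
have y_l k : F z * l_up F k z = ycoord k z by rewrite /l_up mulrC divfK // F0.
transitivity (ycoord 0 z * Dx 0 f z + ycoord 1 z * Dx 1 f z -
  ((2 * spray F 0 z) * Dy 0 f z + (2 * spray F 1 z) * Dy 1 f z)); first by ring.
by rewrite -e0 -e1 -!y_l; ring.
Qed.

Lemma euler_hom_h1 r f : euler_hom A r f -> euler_hom A r (h1 F f).
Proof.
move=> hf; have h k : euler_hom A r (fun z => delta F k f z * l_up F k z).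
  apply: (euler_hom_ext openA (euler_homM openA (euler_hom_delta k hf)
    (euler_hom_l_up k))) => //.
  exact: addr0.
by apply: (euler_hom_ext openA (euler_homD openA (h 0) (h 1))) => // z _;
  rewrite h1E.
Qed.

Lemma euler_hom_h2 r f : euler_hom A r f -> euler_hom A r (h2 F f).
Proof.
move=> hf; have h k : euler_hom A r (fun z => delta F k f z * m_up F k z).
  apply: (euler_hom_ext openA (euler_homM openA (euler_hom_delta k hf)
    (euler_hom_m_up k))) => //.
  exact: addr0.
apply: (euler_hom_ext openA (euler_homM openA (euler_hom_cst openA e)
  (euler_homD openA (h 0) (h 1)))) => [|z Az]; first exact: add0r.
by rewrite h2E.
Qed.

(** * Conformal change of the metric *)

Context {phi : TV -> R}.
Hypothesis hphi : euler_hom A 0 phi.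
Hypothesis rho_neq0 : forall z, A z ->
  sigma F Isc phi z + eps F z - v2 F phi z ^+ 2 != 0.

Let sphi : smooth_on A phi. Proof. by case: hphi. Qed.

Lemma euler_hom_rho : euler_hom A 0 (rho F Isc phi).
Proof.
have hv := euler_hom_v2 hphi; have hvv := euler_hom_v2 hv.
have hv2 c : euler_hom A 0 (fun z => c * (v2 F phi z * v2 F phi z)).
  apply: (euler_hom_ext openA (euler_homM openA (euler_hom_cst openA c)
    (euler_homM openA hv hv))) => //.
  by ring.
have hI : euler_hom A 0 (fun z => e * (Isc z * v2 F phi z)).
  apply: (euler_hom_ext openA (euler_homM openA (euler_hom_cst openA e)
    (euler_homM openA euler_hom_main_scalar hv))) => //.
  by ring.
have hS := euler_homD openA (euler_homD openA (euler_homD openA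
  (euler_homD openA hvv hI) (hv2 2)) (euler_hom_cst openA e)) (hv2 (-1)).
have SE z : A z -> v2 F (v2 F phi) z + e * (Isc z * v2 F phi z) +
    2 * (v2 F phi z * v2 F phi z) + e + -1 * (v2 F phi z * v2 F phi z) =
    sigma F Isc phi z + eps F z - v2 F phi z ^+ 2.
  by move=> Az; rewrite /sigma (epsE Az); ring.
apply: (euler_hom_ext openA (euler_homV openA hS _)) => [z Az||z Az].
- by rewrite SE // rho_neq0.
- exact: oppr0.
- by rewrite SE.
Qed.

Definition shift_scal z : R :=
  v2 F phi z * h1 F phi z + v2 F (h1 F phi) z - 2 * h2 F phi z.

Lemma euler_hom_shift_scal : euler_hom A 0 shift_scal.
Proof.
have hh := euler_hom_h1 hphi.
apply: (euler_hom_ext openA (euler_homD openA (euler_homD openA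
  (euler_hom_ext openA (euler_homM openA (euler_hom_v2 hphi) hh)
    (addr0 _) (fun _ _ => erefl)) (euler_hom_v2 hh))
  (euler_hom_ext openA (euler_homM openA (euler_hom_cst openA (-2))
    (euler_hom_h2 hphi)) (addr0 _) (fun _ _ => erefl)))) => // z _.
by rewrite mulNr.
Qed.

Lemma scalQE z : A z -> scalQ F Isc phi z =
  2^-1 * e * (rho F Isc phi z * (sqF F z * shift_scal z)).
Proof. by move=> Az; rewrite /scalQ (epsE Az) /sqF /shift_scal; ring. Qed.

Lemma scalPE z : scalP F Isc phi z =
  2^-1 * (- (v2 F phi z * (rho F Isc phi z * (sqF F z * shift_scal z)))
    + sqF F z * h1 F phi z).
Proof. by rewrite /scalP /sqF /shift_scal; ring. Qed.

Lemma euler_hom_scalQ : euler_hom A 2 (scalQ F Isc phi).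
Proof.
apply: (euler_hom_ext openA (euler_homM openA (euler_hom_cst openA (2^-1 * e))
  (euler_homM openA euler_hom_rho (euler_homM openA euler_hom_sqF
    euler_hom_shift_scal)))) => [|z Az]; first by ring.
by rewrite scalQE.
Qed.

Lemma euler_hom_scalP : euler_hom A 2 (scalP F Isc phi).
Proof.
have hW : euler_hom A 2 (fun z => -1 * (v2 F phi z * (rho F Isc phi z *
    (sqF F z * shift_scal z)))).
  apply: (euler_hom_ext openA (euler_homM openA (euler_hom_cst openA (-1))
    (euler_homM openA (euler_hom_v2 hphi) (euler_homM openA euler_hom_rho
      (euler_homM openA euler_hom_sqF euler_hom_shift_scal))))) => //.
  by ring.
have hh : euler_hom A 2 (fun z => sqF F z * h1 F phi z).
  exact: (euler_hom_ext openA (euler_homM openA euler_hom_sqF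
    (euler_hom_h1 hphi)) (addr0 _) (fun _ _ => erefl)).
apply: (euler_hom_ext openA (euler_homM openA (euler_hom_cst openA 2^-1)
  (euler_homD openA hW hh))) => [|z Az]; first exact: add0r.
by rewrite scalPE mulN1r.
Qed.

Local Notation Fbar := (conformal phi F).
Local Notation E := (fun z => expR (phi z)).

Let sE : smooth_on A E. Proof. exact: smooth_on_expR. Qed.

Lemma smooth_on_conformal : smooth_on A Fbar.
Proof. exact: (smooth_onM openA sE sF). Qed.

Lemma Dy_phi j z : A z -> F z * Dy j phi z = v2 F phi z * m_lo F j z.
Proof. by move=> Az; rewrite (Dy_frame j hphi Az) !mul0r add0r. Qed.

Lemma Dy_conformal j z : A z ->
  Dy j Fbar z = E z * (v2 F phi z * m_lo F j z + Dy j F z).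
Proof.
move=> Az; transitivity (E z * Dy j F z + F z * (E z * Dy j phi z)).
  by have := dyM j sE sF Az; rewrite (dy_expR j sphi Az).
by rewrite -Dy_phi //=; ring.
Qed.

(** Differentiate [Dy_conformal] once more. The coefficient of m_i m_j collects (phi_;2)^2 twice,
    from the product of first derivatives and from the exponential, phi_;2;2, and e I phi_;2 from
    the derivative of m_j: together [sigma], plus [e] from that of l_j. *)
Lemma gmx_conformal i j z : A z -> gmx Fbar z i j = E z ^+ 2 *
  (Dy i F z * Dy j F z
   + v2 F phi z * (m_lo F i z * Dy j F z + Dy i F z * m_lo F j z)
   + (sigma F Isc phi z + e) * (m_lo F i z * m_lo F j z)).
Proof.
move=> Az; have hv := euler_hom_v2 hphi; have sv := hv.1.
have sm := (euler_hom_m_lo j).1; have sL := (euler_hom_l_lo j).1.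
have svm := smooth_onM openA sv sm; have svmL := smooth_onD openA svm sL.
rewrite (gmxE i j smooth_on_conformal Az) (dy_ext openA i (@Dy_conformal j) Az).
rewrite !Dy_conformal // (dyM i sE svmL Az) (dyD i svm sL Az) (dyM i sv sm Az).
rewrite (dy_expR i sphi Az) /sigma (epsE Az) -[conformal _ _ _]/(E z * F z) /=.
have dphi := Dy_phi i Az; have dL := Dy_l_lo i j Az; have dm := Dy_m_lo i j Az.
have dv : F z * Dy i (v2 F phi) z = v2 F (v2 F phi) z * m_lo F i z.
  by rewrite (Dy_frame i hv Az) !mul0r add0r.
move: dphi dL dm dv.
move: (expR (phi z)) (F z) (v2 F phi z) (m_lo F i z) (m_lo F j z) (Dy i F z)
  (Dy j F z) (Dy i phi z) (Dy i (Dy j F) z) (Dy i (m_lo F j) z)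
  (Dy i (v2 F phi) z) (v2 F (v2 F phi) z) (Isc z).
move=> x f v mi mj Li Lj dphi dL dm dv vv I Hp HL Hm Hv.
transitivity (x * x * ((v * mi + Li) * (v * mj + Lj) + (v * mj + Lj) * (f *
  dphi)
  + v * (f * dm) + mj * (f * dv) + f * dL)); first by ring.
by rewrite Hp HL Hm Hv; ring.
Qed.

Lemma gmx_conformal_unit z : A z -> gmx Fbar z \in unitmx.
Proof.
move=> Az; rewrite unitmxE unitfE det2E !gmx_conformal //=.
have x0 : expR (phi z) != 0 by rewrite gt_eqF // expR_gt0.
have := rho_neq0 Az; rewrite (epsE Az).
have : Dy 0 F z * m_lo F 1 z - Dy 1 F z * m_lo F 0 z != 0.
  rewrite m_lo0E // m_lo1E //; have := gvol_neq0 Az; apply: contra_neq => h.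
  transitivity (gvol z * (l_up F 0 z * Dy 0 F z + l_up F 1 z * Dy 1 F z)).
    by rewrite l_up_l_lo // mulr1.
  by rewrite -h; ring.
move: x0; move: (expR (phi z)) (sigma F Isc phi z) (v2 F phi z).
move: (m_lo F 0 z) (m_lo F 1 z) (Dy 0 F z) (Dy 1 F z).
move=> m0 m1 L0 L1 x s v x0 V0 K0.
(* In the coframe the metric has rows (1, v), (v, s + e) up to the factor [x ^+ 2], with determinant
   s + e - v^2; the change of coframe contributes the square. *)
rewrite [X in X != 0](_ : _ = x ^+ 4 * ((s + e - v ^+ 2) * (L0 * m1 - L1 * m0)
  ^+ 2)).
  by rewrite !mulf_neq0 // expf_neq0.
by ring.
Qed.

Lemma gmx_conformal_l_up j z : A z ->
  gmx Fbar z j 0 * l_up F 0 z + gmx Fbar z j 1 * l_up F 1 z =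
  E z ^+ 2 * (Dy j F z + v2 F phi z * m_lo F j z).
Proof.
move=> Az; rewrite !gmx_conformal //=.
have := l_up_m_lo Az; have := l_up_l_lo Az.
move: (expR (phi z)) (sigma F Isc phi z) (v2 F phi z) (m_lo F j z) (Dy j F z).
move: (m_lo F 0 z) (m_lo F 1 z) (Dy 0 F z) (Dy 1 F z) (l_up F 0 z) (l_up F 1 z).
move=> m0 m1 L0 L1 l0 l1 x s v m L ll lm.
transitivity (x ^+ 2 * ((L + v * m) * (l0 * L0 + l1 * L1)
  + (v * L + (s + e) * m) * (l0 * m0 + l1 * m1))); first by ring.
by rewrite ll lm; ring.
Qed.

Lemma gmx_conformal_m_up j z : A z ->
  gmx Fbar z j 0 * m_up F 0 z + gmx Fbar z j 1 * m_up F 1 z =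
  E z ^+ 2 * (e * (v2 F phi z * Dy j F z + (sigma F Isc phi z + e) * m_lo F j
    z)).
Proof.
move=> Az; rewrite !gmx_conformal //=.
have := m_lo_m_up Az; have := l_lo_m_up Az.
move: (expR (phi z)) (sigma F Isc phi z) (v2 F phi z) (m_lo F j z) (Dy j F z).
move: (m_lo F 0 z) (m_lo F 1 z) (Dy 0 F z) (Dy 1 F z) (m_up F 0 z) (m_up F 1 z).
move=> m0 m1 L0 L1 l0 l1 x s v m L ll lm.
transitivity (x ^+ 2 * ((L + v * m) * (L0 * l0 + L1 * l1)
  + (v * L + (s + e) * m) * (m0 * l0 + m1 * l1))); first by ring.
by rewrite ll lm; ring.
Qed.

Lemma Dy_sqF_conformal j z : A z ->
  Dy j (sqF Fbar) z = E z ^+ 2 * (2 * sqF F z * Dy j phi z + Dy j (sqF F) z).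
Proof.
move=> Az; rewrite (Dy_sqF j smooth_on_conformal Az) (Dy_sqF j sF Az).
rewrite (Dy_conformal j Az) -Dy_phi // /sqF /conformal /=.
by ring.
Qed.

Lemma Dx_sqF_conformal j z : A z ->
  Dx j (sqF Fbar) z = E z ^+ 2 * (2 * sqF F z * Dx j phi z + Dx j (sqF F) z).
Proof.
move=> Az; rewrite (Dx_sqF j smooth_on_conformal Az) (Dx_sqF j sF Az).
have -> : Dx j Fbar z = E z * Dx j F z + F z * (E z * Dx j phi z).
  by have := dxM j sE sF Az; rewrite (dx_expR j sphi Az).
by rewrite /sqF /conformal /=; ring.
Qed.

Lemma delta_sqF_conformal j z : A z ->
  delta F j (sqF Fbar) z = 2 * E z ^+ 2 * sqF F z * delta F j phi z.
Proof.
move=> Az; have := delta_sqF j Az.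
rewrite !deltaE !Dx_sqF_conformal // !Dy_sqF_conformal //= => h.
set d := Dx j phi z + _; move: h; set D := Dx j (sqF F) z + _ => h.
transitivity (expR (phi z) ^+ 2 * D + 2 * expR (phi z) ^+ 2 * sqF F z * d).
  by rewrite /D /d; ring.
by rewrite h mulr0 add0r.
Qed.

Lemma spray_field_conformal z : A z ->
  spray_field (sqF Fbar) z = 2 * E z ^+ 2 * sqF F z * (F z * h1 F phi z).
Proof.
move=> Az; rewrite -spray_field_h1 //; have := spray_field_sqF Az.
rewrite /spray_field !Dx_sqF_conformal // !Dy_sqF_conformal //=.
set D := (X in X = 0) => h.
set d := (X in _ = _ * X).
transitivity (expR (phi z) ^+ 2 * D + 2 * expR (phi z) ^+ 2 * sqF F z * d).
  by rewrite /D /d; ring.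
by rewrite h mulr0 add0r.
Qed.

Lemma Dy_spray_field_conformal j z : A z ->
  Dy j (spray_field (sqF Fbar)) z = 2 * E z ^+ 2 * sqF F z *
    (3 * h1 F phi z * Dy j F z
     + (2 * v2 F phi z * h1 F phi z + v2 F (h1 F phi) z) * m_lo F j z).
Proof.
move=> Az; have hh := euler_hom_h1 hphi; have sh := hh.1.
have sFh := smooth_onM openA sF sh; have sEE := smooth_onM openA sE sE.
have sFF := smooth_onM openA smooth_on_sqFF sFh.
have sEF := smooth_onM openA sEE sFF; have s2 := smooth_on_cst openA (2 : R).
have -> : Dy j (spray_field (sqF Fbar)) z =
    Dy j (fun z => 2 * (E z * E z * (sqF F z * (F z * h1 F phi z)))) z.
  apply: (dy_ext openA) => // z' Az'; rewrite spray_field_conformal //=.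
  by ring.
rewrite (dyM j s2 sEF Az) dy_cst (dyM j sEE sFF Az) (dyM j sE sE Az).
rewrite (dyM j smooth_on_sqFF sFh Az) (dyM j sF sh Az) (Dy_sqF j sF Az).
rewrite (dy_expR j sphi Az) /sqF /=.
have dphi := Dy_phi j Az.
have dh : F z * Dy j (h1 F phi) z = v2 F (h1 F phi) z * m_lo F j z.
  by rewrite (Dy_frame j hh Az) !mul0r add0r.
move: dphi dh.
move: (expR (phi z)) (F z) (v2 F phi z) (m_lo F j z) (Dy j F z) (Dy j phi z)
  (h1 F phi z) (Dy j (h1 F phi) z) (v2 F (h1 F phi) z).
move=> x f v m L p h dh vh Hp Hh.
transitivity (2 * x ^+ 2 * f ^+ 2 * (2 * h * (f * p) + 3 * h * L + f * dh)).
  by ring.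
by rewrite Hp Hh; ring.
Qed.

Lemma spray_conformal i z : A z ->
  spray Fbar i z = spray F i z + (scalP F Isc phi z * l_up F i z
    + scalQ F Isc phi z * m_up F i z).
Proof.
move=> Az; apply: (spray_solve (w := fun i => spray F i z +
  (scalP F Isc phi z * l_up F i z + scalQ F Isc phi z * m_up F i z))).
  exact: gmx_conformal_unit.
move=> j; rewrite (spray_cov_delta j (smooth_on_sqF smooth_on_conformal) Az).
rewrite delta_sqF_conformal // Dy_spray_field_conformal // delta_frame //.
have H k : Dy j (Dy k (sqF Fbar)) z = 2 * gmx Fbar z j k.
  by rewrite gmx_Dy; field.
rewrite !H; have gl := gmx_conformal_l_up j Az;
  have gm := gmx_conformal_m_up j Az.
set P := scalP _ _ _ _; set Q := scalQ _ _ _ _.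
transitivity (4 * (gmx Fbar z j 0 * spray F 0 z + gmx Fbar z j 1 * spray F 1 z)
  + 4 * (P * (gmx Fbar z j 0 * l_up F 0 z + gmx Fbar z j 1 * l_up F 1 z)
  + Q * (gmx Fbar z j 0 * m_up F 0 z + gmx Fbar z j 1 * m_up F 1 z)));
    first by ring.
rewrite gl gm /P /Q scalPE scalQE // /rho /shift_scal (epsE Az) /=.
have := rho_neq0 Az; rewrite (epsE Az); have := eps_sqr Az.
move: (expR (phi z)) (sqF F z) (v2 F phi z) (m_lo F j z) (Dy j F z).
move: (h1 F phi z) (v2 F (h1 F phi) z) (h2 F phi z) (sigma F Isc phi z).
move: (spray F 0 z) (spray F 1 z) (gmx Fbar z j 0) (gmx Fbar z j 1).
move=> G0 G1 g0 g1 h vh h' s x f v m L ee K0.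
set W := v * h + vh - 2 * h'.
(* With r = rho W, the definitions read 2 P = F^2 (h - v r) and 2 Q = e F^2 r. The l_j component of
   the system then holds by e e = 1, and the m_j component is this relation, the definition of rho
   cleared of its denominator. *)
have D : (s + e) * ((s + e - v ^+ 2)^-1 * W) = W + v ^+ 2 * ((s + e - v ^+ 2)^-1
  * W).
  by field.
move: D; set r := (s + e - v ^+ 2)^-1 * W => D.
transitivity (4 * (g0 * G0 + g1 * G1) + 2 * x ^+ 2 * f *
  ((h - v * r + (e * e) * (v * r)) * L
   + (v * h - v ^+ 2 * r + (e * e) * ((s + e) * r)) * m));
     first by rewrite /r /W; field; exact: K0.
by rewrite ee D /W; ring.
Qed.

Lemma barthel_conformal i j z : A z ->
  F z * barthel Fbar i j z =
    F z * barthel F i j z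
    + 2 * scalP F Isc phi z * l_up F i z * l_lo F j z
    + (v2 F (scalP F Isc phi) z - scalQ F Isc phi z) * l_up F i z * m_lo F j z
    + 2 * scalQ F Isc phi z * l_lo F j z * m_up F i z
    + (eps F z * scalP F Isc phi z + v2 F (scalQ F Isc phi) z
       - eps F z * Isc z * scalQ F Isc phi z) * m_up F i z * m_lo F j z.
Proof.
move=> Az.
have barthelE f : barthel f i j z = Dy j (spray f i) z by rewrite Dy.unlock.
have l_loE : l_lo F j z = Dy j F z by rewrite Dy.unlock.
rewrite !barthelE l_loE (epsE Az).
have hP := euler_hom_scalP; have hQ := euler_hom_scalQ.
have sl := (euler_hom_l_up i).1; have sm := (euler_hom_m_up i).1.
have sPl := smooth_onM openA hP.1 sl; have sQm := smooth_onM openA hQ.1 sm.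
rewrite (dy_ext openA j (@spray_conformal i) Az).
rewrite (dyD j (smooth_on_spray i) (smooth_onD openA sPl sQm) Az).
rewrite (dyD j sPl sQm Az) (dyM j hP.1 sl Az) (dyM j hQ.1 sm Az).
(* Degree 2 of P and Q gives the terms in l_j; the derivatives of l^i and m^i give the corrections e
   P, -Q and -e I Q. *)
have dP := Dy_frame j hP Az; have dQ := Dy_frame j hQ Az.
have dl := Dy_l_up j i Az; have dm := Dy_m_up j i Az.
transitivity (F z * Dy j (spray F i) z
  + scalP F Isc phi z * (F z * Dy j (l_up F i) z)
  + l_up F i z * (F z * Dy j (scalP F Isc phi) z)
  + scalQ F Isc phi z * (F z * Dy j (m_up F i) z)
  + m_up F i z * (F z * Dy j (scalQ F Isc phi) z)); first by ring.
by rewrite dP dQ dl dm; ring.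
Qed.

End Frame.

(** * From homogeneity to Euler's relation *)

Lemma smooth_on_subset {R : realType} {V : normedModType R} (A B : set V)
    (f : V -> R) : B `<=` A -> smooth_on A f -> smooth_on B f.
Proof. by move=> BA sf s z /BA Az; exact: sf. Qed.

(** Differentiate f(x, (u + 1) y) = (u + 1)^n f(x, y) at u = 0. The equality is available only where
    u + 1 > 0, hence only near 0. *)
Lemma homogeneous_euler {R : realType} {A : set ('rV[R]_2 * 'rV[R]_2)} {n : nat}
    (f : 'rV[R]_2 * 'rV[R]_2 -> R) : smooth_on A f ->
  (forall z (k : R), A z -> 0 < k -> f (z.1, k *: z.2) = k ^+ n * f z) ->
  euler_hom A n%:R f.
Proof.
move=> sf fn; split=> // z Az.
have df := smooth_on_differentiable sf Az.
pose y : 'rV[R]_2 * 'rV[R]_2 := (0, z.2).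
have yE : y = ycoord 0 z *: (0, delta_mx 0 0) + ycoord 1 z *: (0, delta_mx 0 1).
  rewrite /y [in LHS](row_sum_delta z.2) sum2E.
  by apply: injective_projections => //=; rewrite !scaler0 addr0.
have -> : ycoord 0 z * Dy 0 f z + ycoord 1 z * Dy 1 f z = 'D_y f z.
  by rewrite Dy.unlock /dy !deriveE // yE linearD !linearZ.
have lineE : \forall u \near (0 : R), f (u *: y + z) = (u + 1) ^+ n * f z.
  near=> u; have u1 : 0 < u + 1.
    rewrite -ltrBlDr sub0r; near: u; apply: lt_nbhsr.
    by rewrite ltrN10.
  rewrite -fn //; congr (f _); rewrite /y.
  by apply: injective_projections => /=;
    rewrite ?scaler0 ?add0r // scalerDl scale1r.
have d1 : is_derive (0 : R) 1 (fun u => f (u *: y + z)) ('D_y f (0 *: y + z)).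
  by apply: is_derive_line; rewrite scale0r add0r.
have d2 : is_derive (0 : R) 1 (fun u => (u + 1) ^+ n * f z) (n%:R * f z).
  have -> : (fun u : R => (u + 1) ^+ n * f z) =
      ((id : R -> R) + cst 1) ^+ n * cst (f z).
    by apply/funext => u; rewrite fctE exprfctE.
  apply: is_derive_eq; rewrite !fctE /= add0r addr0 !expr1n !mulr1.
  by rewrite scaler0 add0r /GRing.scale /= mulr1 mulrC.
have : 'D_1 (fun u : R => f (u *: y + z)) 0 =
    'D_1 (fun u : R => (u + 1) ^+ n * f z) 0.
  exact: near_eq_derive lineE.
rewrite (@derive_val _ _ _ _ _ _ _ d1) (@derive_val _ _ _ _ _ _ _ d2).
by rewrite scale0r add0r.
Unshelve. all: by end_near. Qed.

Lemma sgr_mull_gt0 {R : realDomainType} (a b : R) :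
  0 < Num.sg a * b -> Num.sg b = Num.sg a.
Proof.
case: (ltrgt0P a) => [a0|a0|->]; last by rewrite sgr0 mul0r ltxx.
  by rewrite (gtr0_sg a0) mul1r => /gtr0_sg.
by rewrite (ltr0_sg a0) mulN1r oppr_gt0 => /ltr0_sg.
Qed.

(** Near a point of signature [e], the inequality e det g > 0 persists by continuity and forces the
    sign of det g to stay [e]. *)
Lemma open_eps_eq {R : realType} {A : set ('rV[R]_2 * 'rV[R]_2)}
    (F : 'rV[R]_2 * 'rV[R]_2 -> R) (e : R) : open A -> euler_hom A 1 F ->
  (forall z, A z -> gmx F z \in unitmx) -> open [set z | A z /\ eps F z = e].
Proof.
move=> oA hF gU; rewrite openE => z [Az ez]; rewrite /interior /=.
have dg := smooth_on_differentiable (euler_hom_gdet oA hF).1 Az.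
have cg : {for z, continuous (fun z => e * gdet (F := F) z)}.
  apply: continuousM; first exact: cst_continuous.
  exact: differentiable_continuous dg.
have epos : 0 < e * gdet (F := F) z.
  rewrite -ez /eps gdetE -normrEsg normr_gt0 -gdetE.
  by have := gU z Az; rewrite unitmxE unitfE.
have near_pos : nbhs z [set w | 0 < e * gdet (F := F) w].
  exact: (cvgr_gt _ cg 0 epos).
have nearA := open_nbhs_nbhs (conj oA Az).
apply: filterS (filterI nearA near_pos) => w [Aw /=].
rewrite -ez /eps -gdetE => /sgr_mull_gt0 ew.
by split; [exact: Aw|exact: ew].
Qed.

Theorem proposition3p9 (R : realType) (M : surface R)
    (A : chart M -> set ('rV[R]_2 * 'rV[R]_2))
    (F phi Isc : chart M -> 'rV[R]_2 * 'rV[R]_2 -> R) :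
  conic_pseudo_Finsler_surface A F ->
  (forall c, is_main_scalar (A c) (F c) (Isc c)) ->
  smooth_function A phi ->
  homogeneous 0 A phi ->
  (forall c z, A c z ->
    sigma (F c) (Isc c) (phi c) z + eps (F c) z - v2 (F c) (phi c) z ^+ 2
      != 0) ->
  forall (c : chart M) (z : 'rV[R]_2 * 'rV[R]_2), A c z ->
  forall i j : 'I_2,
    let F' := F c in
    let I' := Isc c in
    let P := scalP F' I' (phi c) in
    let Q := scalQ F' I' (phi c) in
    let Fbar := conformal (phi c) F' in
    F' z * barthel Fbar i j z =
      F' z * barthel F' i j z
      + 2 * P z * l_up F' i z * l_lo F' j z
      + (v2 F' P z - Q z) * l_up F' i z * m_lo F' j z
      + 2 * Q z * l_lo F' j z * m_up F' i z
      + (eps F' z * P z + v2 F' Q z - eps F' z * I' z * Q z)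
        * m_up F' i z * m_lo F' j z.
Proof.
move=> [subA [_ sF] hF gU F0] IscE [_ sphi] hphi rho0 c z Az i j.
have oA : open (A c) by exact: (cs_open subA).
have eF := homogeneous_euler (sF c) (hF c).
have ephi := homogeneous_euler (sphi c) (hphi c).
(* The claim at [z] involves only derivatives there, so an open neighbourhood of [z] with constant
   signature suffices. *)
pose B := [set w | A c w /\ eps (F c) w = eps (F c) z].
have BA : B `<=` A c by move=> w [].
have euler_hom_B r f : euler_hom (A c) r f -> euler_hom B r f.
  by move=> [sf ef]; split=> [|w /BA/ef //]; exact: smooth_on_subset sf.
have oB : open B := open_eps_eq oA eF (gU c).
have F0B w : B w -> F c w != 0 by move=> /BA; exact: F0.
have gUB w : B w -> gmx (F c) w \in unitmx by move=> /BA; exact: gU.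
have epsB w : B w -> eps (F c) w = eps (F c) z by case.
have IscB : is_main_scalar B (F c) (Isc c) by move=> w /BA; exact: IscE.
have rhoB w : B w -> sigma (F c) (Isc c) (phi c) w + eps (F c) w
  - v2 (F c) (phi c) w ^+ 2 != 0 by move=> /BA; exact: rho0.
have Bz : B z by split.
lazy zeta.
exact: (barthel_conformal oB (euler_hom_B _ _ eF) F0B gUB epsB IscB
  (euler_hom_B _ _ ephi) rhoB i j Bz).
Qed.
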